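(* For any $\alpha>0$ and $T>0$, and for any unit vector $v\in\mathbb R^3$, $$\mathbb E^{\widehat{\mathbb P}_{\alpha,T}}\big[\langle v,\omega(T)-\omega(-T)\rangle^2\big]\le\mathbb E^{\mathbb P_T}\big[\langle v,\omega(T)-\omega(-T)\rangle^2\big].$$
   Context: $\mathbb P$ is the law of three-dimensional Brownian motion on $C((-\infty,\infty);\mathbb R^3)$, considered only on the $\sigma$-field generated by the increments $\omega(t)-\omega(s)$, $-\infty<s<t<\infty$, and $\mathbb P_T$ is its restriction to increments over the interval $[-T,T]$. The Polaron measure is $$\widehat{\mathbb P}_{\alpha,T}(d\omega)=\frac1{Z_{\alpha,T}}\exp\Big\{\frac\alpha2\int_{-T}^T\int_{-T}^T\frac{e^{-|t-s|}}{|\omega(t)-\omega(s)|}\,dt\,ds\Big\}\,\mathbb P_T(d\omega),$$ where $Z_{\alpha,T}<\infty$ is the normalizing constant. *)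

(* Defs.v *)
From HB Require Import structures.
From mathcomp Require Import all_boot all_order all_algebra.
From mathcomp Require Import all_classical all_reals all_analysis.
From mathcomp Require Import measurable_realfun.
From mathcomp Require Import ring lra.

Set Implicit Arguments.
Unset Strict Implicit.
Unset Printing Implicit Defensive.
Import Order.TTheory GRing.Theory Num.Theory.
Import numFieldNormedType.Exports.
Local Open Scope classical_set_scope.
Local Open Scope ring_scope.

(* The library norm on ['rV[R]_n] is the sup norm, hence these definitions. *)
Definition dotv (R : realType) (n : nat) (u v : 'rV[R]_n) : R :=
  \sum_(i < n) u 0 i * v 0 i.

Definition enorm (R : realType) (n : nat) (u : 'rV[R]_n) : R :=
  Num.sqrt (dotv u u).

Definition cpath (R : realType) : Type := continuousType R 'rV[R]_3.

HB.instance Definition _ (R : realType) := gen_eqMixin (cpath R).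
HB.instance Definition _ (R : realType) := gen_choiceMixin (cpath R).
HB.instance Definition _ (R : realType) :=
  isPointed.Build (cpath R) (cst 0 : continuousType R 'rV[R]_3).

Definition cpath_fun (R : realType) (w : cpath R) : R -> 'rV[R]_3 :=
  (w : continuousType R 'rV[R]_3).
Coercion cpath_fun : cpath >-> Funclass.

(* Borel events of the coordinates of w(t) - w(s), for s < t in I; they
   generate the same sigma-field as the R^3-valued increments. *)
Definition incr_events (R : realType) (I : set R) : set (set (cpath R)) :=
  [set A | exists s t (i : 'I_3) (B : set R),
    [/\ I s, I t, s < t, measurable B &
        A = [set w : cpath R | B ((w t - w s) 0 i)]]].

Definition path_on (R : realType) (I : set R) : Type :=
  g_sigma_algebraType (incr_events I).

HB.instance Definition _ (R : realType) (I : set R) :=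
  Measurable.on (path_on I).

(* P is the law of the increments of three-dimensional Brownian motion indexed
   by the whole line: increments over consecutive time intervals are
   independent, and w(t) - w(s) is N(0, (t - s) Id_3), i.e. has independent
   coordinates of law N(0, t - s). The second parameter of [normal_prob] is
   the standard deviation. *)
Definition brownian_law (R : realType)
    (P : probability (path_on [set: R]) R) : Prop :=
  forall (n : nat) (t : nat -> R) (B : 'I_n -> 'I_3 -> set R),
    (forall k : 'I_n, t k < t k.+1) ->
    (forall k i, measurable (B k i)) ->
    P [set w : cpath R | forall (k : 'I_n) (i : 'I_3),
         B k i ((w (t k.+1) - w (t k)) 0 i)] =
    (\prod_(k < n) \prod_(i < 3)
       normal_prob 0 (Num.sqrt (t k.+1 - t k)) (B k i))%E.

Lemma incr_measurable_sub (R : realType) (I J : set R) (A : set (cpath R)) :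
  I `<=` J -> measurable (A : set (path_on I)) ->
  measurable (A : set (path_on J)).
Proof.
move=> IJ; apply: sub_sigma_algebra2 => _ [s [t [i [B [Is It st mB ->]]]]].
by exists s, t, i, B; split => //; exact: IJ.
Qed.

(* Restriction of P to the increments over I; it is the same set function on
   the smaller sigma-field. *)
Section restriction.
Context (R : realType) (P : probability (path_on [set: R]) R) (I : set R).
Local Open Scope ereal_scope.

Definition restr_law : set (path_on I) -> \bar R := fun A => P A.

Let restr0 : restr_law set0 = 0. Proof. exact: measure0. Qed.

Let restr_ge0 A : 0 <= restr_law A. Proof. exact: measure_ge0. Qed.

Let restr_sigma_additive : semi_sigma_additive restr_law.
Proof.
move=> F mF tF mUF; apply: (@measure_semi_sigma_additive _ _ _ P F) => //.
- by move=> n; apply: (incr_measurable_sub _ (mF n)).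
- exact: (incr_measurable_sub _ mUF).
Qed.

HB.instance Definition _ := isMeasure.Build _ _ _
  restr_law restr0 restr_ge0 restr_sigma_additive.

Let restr_setT : restr_law setT = 1. Proof. exact: probability_setT. Qed.

HB.instance Definition _ :=
  Measure_isProbability.Build _ _ _ restr_law restr_setT.

End restriction.
Arguments restr_law {R} P I _.

Definition window (R : realType) (T : R) : set R := `[- T, T].

Section measurability_lemmas.
Context (R : realType).

Lemma measurable_fun_caratheodory d (X : measurableType d) (h : X -> R -> R) :
  (forall t, measurable_fun setT (h^~ t)) -> (forall x, continuous (h x)) ->
  measurable_fun setT (fun z : X * R => h z.1 z.2).
Proof.
move=> mh ch.
pose q (n : nat) (t : R) : R := (Num.floor (t * n.+1%:R))%:~R / n.+1%:R.
apply: (@measurable_fun_cvg _ _ _ _ (fun n (z : X * R) => h z.1 (q n z.2))).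
  move=> n _ B mB; rewrite setTI.
  have -> : (fun z : X * R => h z.1 (q n z.2)) @^-1` B = \bigcup_(k : int)
      ((h^~ (k%:~R / n.+1%:R) @^-1` B) `*`
       ((fun t : R => t * n.+1%:R) @^-1` `[k%:~R, (k + 1)%:~R[)).
    apply/seteqP; split => -[x t] /=.
      move=> Bx; exists (Num.floor (t * n.+1%:R)) => //=; split => //=.
      by rewrite in_itv/= floor_itv.
    move=> [k _ /= [Bx]]; rewrite in_itv/= => tk.
    by rewrite /q (@floor_def _ _ k).
  apply: countable_bigcupT_measurable => [|k]; first exact: countableP.
  apply: measurableX; first by rewrite -[X in measurable X]setTI; exact: mh.
  rewrite -[X in measurable X]setTI.
  by apply: measurable_funM => //; exact: measurable_itv.
move=> [x t] _ /=.
suff qt : (q n t) @[n --> \oo] --> t by exact: (cvg_comp _ _ qt (ch x t)).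
apply/cvgrPdist_le => e e0.
have /cvgrPdist_le /(_ _ e0) := @cvg_harmonic R.
apply: filterS => n; rewrite sub0r normrN /= ger0_norm ?invr_ge0//.
apply: le_trans.
have n0 : 0 < n.+1%:R :> R by rewrite ltr0n.
have /andP[h1 h2] := floor_itv (t * n.+1%:R).
have -> : t - q n t = (t * n.+1%:R - (Num.floor (t * n.+1%:R))%:~R) / n.+1%:R.
  by rewrite mulrBl mulfK// lt0r_neq0.
rewrite ger0_norm; last first.
  by apply: mulr_ge0; [rewrite subr_ge0|rewrite invr_ge0 ltW].
rewrite -[leRHS]mul1r ler_pM2r ?invr_gt0//.
by rewrite lerBlDl; move: h2; rewrite intrD => /ltW.
Qed.

Lemma measurable_inver : measurable_fun setT (fun r : R => (r%:E)^-1%E).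
Proof.
under eq_fun do rewrite inver.
apply: measurable_fun_if => //.
- apply: (measurable_fun_bool true); rewrite setTI.
  rewrite [X in measurable X](_ : _ = [set 0]); first exact: measurable_set1.
  by apply/seteqP; split => r /= /eqP.
- apply/measurable_EFinP; rewrite setTI.
  rewrite [X in measurable_fun X](_ : _ = ~` [set 0]); last first.
    by apply/seteqP; split => r /=; [move/negbT/eqP|move/eqP/negbTE].
  apply: open_continuous_measurable_fun; last first.
    by move=> r; rewrite inE => /eqP r0; exact: inv_continuous.
  apply/closed_openC/accessible_closed_set1/hausdorff_accessible.
  exact: norm_hausdorff.
Qed.

Lemma measurable_expeR : measurable_fun setT (@expeR R).
Proof.
rewrite [X in measurable_fun _ X](_ : _ = (fun z : \bar R =>
   if z == +oo%E then +oo%E else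
   if z == -oo%E then 0%E else (expR (fine z))%:E)); last first.
  by apply/funext => -[].
have H (a : \bar R) : measurable_fun setT (fun z : \bar R => z == a).
  apply: (measurable_fun_bool true); rewrite setTI.
  rewrite [X in measurable X](_ : _ = [set a]); first exact: emeasurable_set1.
  by apply/seteqP; split => r /= /eqP.
apply: measurable_fun_ifT => //; apply: measurable_fun_ifT => //.
apply/measurable_EFinP; apply: measurableT_comp => //; exact: measurable_fine.
Qed.
End measurability_lemmas.

Section polaron_action.
Context (R : realType).
Local Open Scope ereal_scope.
Local Notation mu := (@lebesgue_measure R).

(* Inversion is in [\bar R]: the integrand is +oo where w(t) = w(s). *)
Definition polaron_action (T : R) (w : cpath R) : \bar R :=
  \int[mu]_(t in window T) \int[mu]_(s in window T)
    ((expR (- `|t - s|))%:E / (enorm (w t - w s))%:E).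

Lemma measurable_window (T : R) : measurable (window T).
Proof. exact: measurable_itv. Qed.

Lemma windowP (T t : R) : window T t <-> (- T <= t <= T)%R.
Proof. by rewrite /window /= in_itv. Qed.

Lemma measurable_incr (I : set R) (s t : R) (i : 'I_3) : I s -> I t ->
  measurable_fun setT 
    (fun w : path_on I => ((w : cpath R) t - (w : cpath R) s)%R 0%R i).
Proof.
move=> Is It.
wlog st : s t Is It / (s <= t)%R.
  move=> H; have [st|/ltW ts] := leP s t; first exact: H.
  rewrite (_ : (fun _ => _) = (fun w : path_on I =>
      - ((w : cpath R) s - (w : cpath R) t)%R 0%R i)%R).
    exact: (measurableT_comp (@oppr_measurable R setT) (H t s It Is ts)).
  by apply/funext => w; rewrite !mxE opprB.
have [->|s_neq_t] := eqVneq s t.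
  rewrite (_ : (fun _ => _) = cst 0%R) //.
  by apply/funext => w; rewrite subrr mxE.
move=> _ B mB; rewrite setTI; apply: sub_sigma_algebra.
by exists s, t, i, B; split => //; rewrite lt_neqAle s_neq_t.
Qed.

Lemma measurable_polaron_action (T : R) :
  measurable_fun setT (polaron_action T : path_on (window T) -> \bar R).
Proof.
have [T0|T0] := ltP T (- T)%R.
  rewrite (_ : polaron_action T = cst 0) //; apply/funext => w.
  by rewrite /polaron_action /window set_itv_ge ?integral_set0//
    bnd_simp -ltNge.
pose c (t : R) : R := Num.max (- T)%R (Num.min T t).
have cI t : (window T) (c t).
  by rewrite /window /= in_itv/= /c le_max lexx/= ge_max T0 ge_min lexx.
have cid t : (window T) t -> c t = t.
  by rewrite /window /= in_itv/= /c => /andP[Tt tT]; rewrite (min_idPr tT)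
    (max_idPr Tt).
have cc : continuous c.
  move=> t; apply: (@continuous_max _ R^o (cst (- T)%R) (Num.min T)).
    exact: cvg_cst.
  by apply: (@continuous_min _ R^o (cst T) id); [exact: cvg_cst|exact: cvg_id].
pose X : Type := path_on (window T).
pose h (i : 'I_3) (w : X) (t : R) : R :=
  ((w : cpath R) (c t) - (w : cpath R) (- T)%R)%R 0%R i.
have mh i : measurable_fun setT (fun z : path_on (window T) * R => h i z.1 z.2).
  apply: measurable_fun_caratheodory => [t|w].
    by apply: measurable_incr => //; apply/windowP; rewrite lexx T0.
  move=> t; rewrite /h; under eq_fun do rewrite !mxE.
  apply: continuousB; last exact: cvg_cst.
  apply: (@continuous_comp _ _ _ (cpath_fun w \o c) (fun M : 'rV_3 => M 0%R i)).
    apply: continuous_comp; first exact: cc.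
    exact: (@cts_fun _ _ (w : continuousType R 'rV[R]_3)).
  exact: coord_continuous.
pose G (z : (path_on (window T) * R) * R) : \bar R :=
  if (z.1.2 \in (window T)) && (z.2 \in (window T)) then
    (expR (- `|z.1.2 - z.2|))%:E /
    (Num.sqrt (\sum_(i < 3) (h i z.1.1 z.1.2 - h i z.1.1 z.2) *
       (h i z.1.1 z.1.2 - h i z.1.1 z.2))%R)%:E
  else 0.
have G0 z : 0 <= G z.
  rewrite /G; case: ifP => // _.
  by apply: mule_ge0; rewrite ?lee_fin ?expR_ge0// inve_ge0 lee_fin sqrtr_ge0.
have mI (f : (path_on (window T) * R) * R -> R) : measurable_fun setT f ->
    measurable_fun setT (fun z => f z \in window T).
  move=> mf; apply: (measurable_fun_bool true); rewrite setTI.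
  rewrite [X in measurable X](_ : _ = f @^-1` window T).
    by rewrite -[X in measurable X]setTI; apply: mf => //;
      exact: measurable_window.
  by apply/seteqP; split => z; [exact: set_mem|exact: mem_set].
have mG : measurable_fun setT G.
  apply: measurable_fun_ifT => //.
    apply: measurable_and; apply: mI => //; exact: measurableT_comp.
  apply: emeasurable_funM.
    apply/measurable_EFinP/measurableT_comp => //.
    apply: (measurableT_comp (@oppr_measurable R setT)).
    apply: (measurableT_comp (@normr_measurable R setT)).
    apply: measurable_funB => //; exact: measurableT_comp.
  apply: (measurableT_comp (@measurable_inver R)).
  apply: (measurableT_comp
    (@continuous_measurable_fun _ _ (@sqrt_continuous R))).
  have m12 i : measurable_fun setT
      (fun z : (path_on (window T) * R) * R => h i z.1.1 z.1.2).
    exact: (measurableT_comp (mh i) measurable_fst).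
  have m13 i : measurable_fun setT
      (fun z : (path_on (window T) * R) * R => h i z.1.1 z.2).
    apply: (measurableT_comp (mh i)
      (g := fun z : (path_on (window T) * R) * R => (z.1.1, z.2))).
    apply: measurable_fun_pair => //; exact: measurableT_comp.
  apply: measurable_sum => i.
  by apply: measurable_funM; apply: measurable_funB.
rewrite (_ : (polaron_action T : path_on (window T) -> \bar R) =
  fubini_F mu (fubini_F mu G)); last first.
  apply/funext => w; rewrite /polaron_action /fubini_F [LHS]integral_mkcond.
  apply: eq_integral => t _; rewrite patchE; case: ifPn => tI; last first.
    rewrite integral0_eq// => s _; rewrite /G/=.
    by rewrite (negbTE tI).
  rewrite [LHS]integral_mkcond; apply: eq_integral => s _; rewrite patchE /G/=.
  rewrite tI/=; case: ifPn => // sI.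
  move: tI sI; rewrite !inE => tI sI; rewrite /enorm /dotv.
  congr (_ / (Num.sqrt _)%:E); apply: eq_bigr => i _.
  by rewrite /h !mxE !cid//; ring.
apply: measurable_fun_fubini_tonelli_F => [|z].
  exact: measurable_fun_fubini_tonelli_F.
by apply: integral_ge0.
Qed.

End polaron_action.

Section polaron.
Context (R : realType) (P : probability (path_on [set: R]) R) (alpha T : R).
Local Open Scope ereal_scope.
Local Notation P_T := (restr_law P (window T)).

Definition polaron_weight (w : cpath R) : \bar R :=
  expeR ((alpha / 2)%:E * polaron_action T w).

Definition polaron_Z : \bar R := \int[P_T]_w polaron_weight w.

Definition polaron_law : set (path_on (window T)) -> \bar R :=
  fun A => \int[P_T]_(w in A) (polaron_weight w / polaron_Z).

Let density_ge0 w : 0 <= polaron_weight w / polaron_Z.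
Proof.
apply: mule_ge0; first exact: expeR_ge0.
by rewrite inve_ge0; apply: integral_ge0 => ? _; exact: expeR_ge0.
Qed.

Lemma measurable_polaron_weight :
  measurable_fun setT (polaron_weight : path_on (window T) -> \bar R).
Proof.
apply: (measurableT_comp (@measurable_expeR R)).
by apply: emeasurable_funM => //; exact: measurable_polaron_action.
Qed.

Let measurable_density : measurable_fun setT
  ((fun w => polaron_weight w / polaron_Z) : path_on (window T) -> \bar R).
Proof.
by apply: emeasurable_funM => //; exact: measurable_polaron_weight.
Qed.

Let polaron0 : polaron_law set0 = 0.
Proof. by rewrite /polaron_law integral_set0. Qed.

Let polaron_ge0 A : 0 <= polaron_law A.
Proof. by apply: integral_ge0 => w _; exact: density_ge0. Qed.

Let polaron_sigma_additive : semi_sigma_additive polaron_law.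
Proof.
move=> F mF tF mUF; rewrite /polaron_law ge0_integral_bigcup//; last first.
  by apply: measurable_funTS; exact: measurable_density.
apply: is_cvg_ereal_nneg_natsum_cond => n _ _; exact: polaron_ge0.
Qed.

HB.instance Definition _ := isMeasure.Build _ _ _
  polaron_law polaron0 polaron_ge0 polaron_sigma_additive.

End polaron.
Arguments polaron_law {R} P alpha T _.

(* Main.v *)
Require Import Defs.
From HB Require Import structures.
From mathcomp Require Import all_boot all_order all_algebra.
From mathcomp Require Import all_classical all_reals all_analysis.
From mathcomp Require Import measurable_realfun.
From mathcomp Require Import ring lra.
Set Implicit Arguments.
Unset Strict Implicit.
Unset Printing Implicit Defensive.
Import Order.TTheory GRing.Theory Num.Theory.
Import numFieldNormedType.Exports.
Local Open Scope classical_set_scope.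
Local Open Scope ring_scope.

(** The exponential of the action is expanded in powers of the action, and
    1 / r = (2 pi)^(-1/2) \int exp(- u^2 r^2 / 2) du turns each power into a
    positive mixture of Gaussian weights exp(- Q), with Q a sum of squares of
    linear functionals of the increments. In turn exp(- u^2 m^2 / 2) is the
    mean of cos(xi m) for xi of law N(0, u^2), so that everything reduces to
    E[cos l cos g] >= E[cos l] E[cos g] for linear functionals l and g of the
    Brownian increments; as E[cos g] = exp(- Var(g) / 2), this is the
    arithmetic-geometric mean inequality combined with the parallelogram law
    for Var. Hence E[(1 - cos l) W] <= E[1 - cos l] E[W] for the Polaron weight
    W; applying this to l / n, multiplying by 2 n^2 and letting n tend to
    infinity (Fatou) gives E[l^2 W] <= E[l^2] E[W]. If Z = E[W] is
    infinite then the density W / Z is 0, as 1 / +oo = 0. *)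

(** The correlation inequality for two cosines is not by itself stable under products, while a power
    of the action brings in many Gaussian weights. The statement carried through the induction
    therefore keeps a spare factor cos(l') with l' arbitrary: a new weight contributes cos(xi m),
    and cos(l') cos(xi m) is half the sum of the cosines of l' + xi m and l' - xi m, two instances
    of the induction hypothesis.

    The proof changes its notion of integral halfway. Up to finite products of Gaussian weights,
    with times and mixing variables u frozen, all functions are bounded by 1, so signed integrals
    and Fubini apply. The action and its exponential may be +oo, and E[cos l W] might then be
    undefined; 1 - cos l is nonnegative, so its inequality makes sense in [0, +oo] and survives
    mixtures and series by Tonelli and monotone convergence. *)

(** * Integration against the image of a measure with a density *)

Section density.
Context d d' (T : measurableType d) (T' : measurableType d') (R : realType).
Variables (mu : {measure set T -> \bar R}) (nu : {measure set T' -> \bar R}).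
Variables (phi : T -> T') (mphi : measurable_fun setT phi).
Local Open Scope ereal_scope.
Import HBNNSimple.

(** [nu] is the image under [phi] of the measure with density [g]. One statement serves the normal
    and Polaron laws, with [phi] the identity, and the law of a random variable, with [phi] that
    variable. The density is extended-valued because the Polaron weight may be +oo. *)
Lemma ge0_integral_density (g : T -> \bar R) (h : T' -> \bar R) :
  measurable_fun setT g -> (forall x, 0 <= g x) ->
  (forall A, measurable A -> nu A = \int[mu]_(x in phi @^-1` A) g x) ->
  measurable_fun setT h -> (forall x, 0 <= h x) ->
  \int[nu]_x h x = \int[mu]_x (h (phi x) * g x).
Proof.
move=> mg g0 nuE mh h0.
pose f := nnsfun_approx measurableT mh.
have f0 n x : 0 <= (f n x)%:E by rewrite lee_fin.
have mf n : measurable_fun setT (EFin \o f n) by exact/measurable_EFinP.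
have ndf x : {homo (fun n => (f n x)%:E) : n m / (n <= m)%N >-> n <= m}.
  by move=> a b ab; rewrite lee_fin; exact/lefP/nd_nnsfun_approx.
have fh x : (f n x)%:E @[n --> \oo] --> h x by exact: cvg_nnsfun_approx.
have fgh x : (f n (phi x))%:E * g x @[n --> \oo] --> h (phi x) * g x.
  have [hx0|hx0] := eqVneq (h (phi x)) 0.
    rewrite hx0 mul0e; under eq_fun => n.
      rewrite (_ : (f n (phi x))%:E = 0) ?mul0e; first over.
      apply/eqP; rewrite eq_le f0 andbT -hx0 -(cvg_lim _ (fh (phi x)))//.
      rewrite (cvg_lim _ (ereal_nondecreasing_cvgn (ndf (phi x))))//.
      by apply: ereal_sup_ubound; exists n.
    exact: cvg_cst.
  have [->|gx0] := eqVneq (g x) 0.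
    by under eq_fun do rewrite mule0; rewrite mule0; exact: cvg_cst.
  apply: cvgeM (fh (phi x)) (cvg_cst _).
  by rewrite mule_defE (negbTE hx0) (negbTE gx0).
have sE n : \int[nu]_x (f n x)%:E = \int[mu]_x ((f n (phi x))%:E * g x).
  pose p (k : R) := f n @^-1` [set k].
  have fE x : (f n x)%:E = \sum_(k \in range (f n)) k%:E * (\1_(p k) x)%:E.
    by rewrite fsumEFin//= fimfunE.
  under eq_integral do rewrite fE.
  have mp k : measurable (p k) by exact: measurable_funPTI.
  have mi k : measurable_fun setT (fun x => k%:E * (\1_(p k) x)%:E).
    by apply: measurable_funeM; exact/measurable_EFinP/measurable_indic.
  rewrite ge0_integral_fsum//; last first.
    - by move=> r x _; exact: nnfun_muleindic_ge0.
  under [RHS]eq_integral => x _.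
    rewrite fE ge0_mule_fsuml; last by move=> r; exact: nnfun_muleindic_ge0.
    over.
  rewrite ge0_integral_fsum//; last 2 first.
    - by move=> r; apply: emeasurable_funM mg;
        exact: (measurableT_comp (mi r) mphi).
    - by move=> r x _; rewrite mule_ge0//; exact: nnfun_muleindic_ge0.
  apply: eq_fsbigr => k; rewrite inE => -[y _ <-].
  rewrite ge0_integralZl//; last exact/measurable_EFinP/measurable_indic.
  under [RHS]eq_integral do rewrite -muleA.
  rewrite ge0_integralZl//; last 2 first.
    - apply: emeasurable_funM mg.
      apply: (measurableT_comp (f := EFin \o \1_(p (f n y))) _ mphi).
      exact/measurable_EFinP/measurable_indic.
    - by move=> x _; rewrite mule_ge0// lee_fin.
  congr (_ * _); rewrite integral_indic//= setIT nuE// integral_mkcond.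
  by apply: eq_integral => x _; rewrite patchE indicE;
    rewrite (_ : (x \in phi @^-1` _) = (phi x \in p (f n y)));
    [case: ifP; rewrite ?mul1e ?mul0e|apply/idP/idP; rewrite !inE].
transitivity (limn (fun n => \int[nu]_x (f n x)%:E)).
  rewrite -monotone_convergence//.
  by apply: eq_integral => x _; apply/esym/cvg_lim.
under eq_fun do rewrite sE.
rewrite -monotone_convergence//.
- by apply: eq_integral => x _; apply/cvg_lim.
- by move=> n; apply: emeasurable_funM mg;
    exact: (measurableT_comp (mf n) mphi).
- by move=> n x _; rewrite mule_ge0.
- by move=> x _ a b ab; apply: lee_wpmul2r => //; exact: ndf.
Qed.

(** Nonnegativity of [g] lets it pass through positive and negative parts, so both sides are the
    same difference of extended integrals. *)
Lemma integral_density (g : T -> R) (h : T' -> R) :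
  measurable_fun setT g -> (forall x, 0 <= g x)%R ->
  (forall A, measurable A -> nu A = \int[mu]_(x in phi @^-1` A) (g x)%:E) ->
  measurable_fun setT h ->
  \int[nu]_x (h x)%:E = \int[mu]_x (h (phi x) * g x)%:E.
Proof.
move=> mg g0 nuE mh; rewrite integralE [RHS]integralE.
have H (k : T' -> \bar R) : measurable_fun setT k -> (forall x, 0 <= k x) ->
    \int[nu]_x k x = \int[mu]_x (k (phi x) * (g x)%:E).
  move=> mk k0; apply: ge0_integral_density => //.
  exact/measurable_EFinP.
rewrite !H//; try by [apply: measurable_funepos; exact/measurable_EFinP|
  apply: measurable_funeneg; exact/measurable_EFinP].
congr (_ - _); apply: eq_integral => x _; rewrite ?funeposE ?funenegE/=.
  by rewrite -EFin_max -EFinM -EFin_max maxr_pMl// mul0r.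
by rewrite -!EFin_max -EFinM maxr_pMl// mul0r mulNr.
Qed.

End density.

(** * Characteristic function of the normal law *)

Section normal_charfun.
Context (R : realType).
Local Notation mu := (@lebesgue_measure R).

(** The fundamental theorem of calculus on [[-n, n]], then dominated convergence with [|f|] as
    bound. It serves as integration by parts on the whole line. *)
Lemma integral_derive_eq0 (F f : R -> R) :
  (forall x : R, is_derive x 1 F (f x)) -> continuous f ->
  mu.-integrable setT (EFin \o f) ->
  F n%:R - F (- n%:R) @[n --> \oo] --> (0 : R) ->
  (\int[mu]_x (f x)%:E = 0)%E.
Proof.
move=> dF cf intf F0.
have mf : measurable_fun setT (EFin \o f) by exact: measurable_int intf.
pose f_ (n : nat) : R -> \bar R := (EFin \o f) \_ `[- n%:R, n%:R].
have [||||_ _] := @dominated_convergence _ _ _ mu _ measurableT f_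
    (EFin \o f) (abse \o (EFin \o f)) _ mf _ _ _.
- by move=> n; apply/(measurable_restrictT _ _).1 => //;
    exact: measurable_funTS.
- apply: aeW => x _; apply: cvg_near_cst; near=> n.
  rewrite /f_ patchE mem_set//= in_itv/= -ler_norml.
  by near: n; exact: nbhs_infty_ger.
- exact: integrable_abse.
- apply: aeW => x n _; rewrite /f_ patchE; case: ifP => // _.
  by rewrite abse0 abse_ge0.
have fE n : (\int[mu]_x f_ n x)%E = (F n%:R - F (- n%:R))%:E.
  rewrite /f_ -integral_mkcond; have [->|n0] := eqVneq n 0%N.
    by rewrite oppr0 set_itv1 integral_set1 subrr.
  rewrite (@continuous_FTC2 _ f F)//.
  - by rewrite -subr_gt0 opprK addr_gt0// ltr0n lt0n.
  - exact: continuous_subspaceT.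
  - have cF : continuous F.
      by move=> x; exact/differentiable_continuous/derivable1_diffP.
    split => [x _||]; first exact: ex_derive.
    + by apply: cvg_at_right_filter; exact: cF.
    + by apply: cvg_at_left_filter; exact: cF.
  - by move=> x _; rewrite derive1E derive_val.
rewrite (_ : [sequence _]_n = (fun n => (F n%:R - F (- n%:R))%:E)); last first.
  by apply/funext => n; exact: fE.
move=> /cvg_lim <-//; apply/cvg_lim => //.
by apply: cvg_EFin F0; exact: nearW.
Unshelve. all: end_near. Qed.

Section pdf.
Variables (s : R).
Hypothesis s0 : s != 0.
Local Notation f := (normal_pdf 0 s).

Lemma is_derive_normal_pdf (x : R) : is_derive x 1 f (- (x / s ^+ 2) * f x).
Proof.
have -> : f = normal_peak s \*: (expR \o ((- (s ^+ 2 *+ 2)^-1) \*: (id ^+ 2))).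
  apply/funext => y; rewrite normal_pdfE// /normal_fun subr0 /=.
  by congr (_ * expR _); rewrite mulNr mulrC -mulNr.
apply: is_derive_eq.
rewrite /= /GRing.scale/= expr1 mulr1; field; exact/negP/negP.
Qed.

Lemma normal_pdf_cvg0 : f n%:R @[n --> \oo] --> (0 : R).
Proof.
have -> : (fun n : nat => f n%:R) =
    (fun n => normal_peak s * expR (- ((s ^+ 2 *+ 2)^-1 * (n%:R ^+ 2)))).
  apply/funext => n; rewrite normal_pdfE// /normal_fun subr0.
  by congr (_ * expR _); rewrite mulNr mulrC.
rewrite -[X in _ --> X](mulr0 (normal_peak s)).
have c0 : 0 < (s ^+ 2 *+ 2)^-1.
  by rewrite invr_gt0 pmulrn_lgt0// exprn_even_gt0.
have h1 : (s ^+ 2 *+ 2)^-1 * x ^+ 2 @[x --> +oo] --> +oo.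
  by apply: gt0_cvgMry => //; exact: cvgr_expr2.
have h := cvg_comp _ _ (@cvgr_idn R) h1.
have e0 := cvg_comp _ _ h (@cvgr_expR R).
exact: (@cvgM _ _ _ _ (cst (normal_peak s)) _ _ _ (cvg_cst _) e0).
Qed.

(** The exponent is half that of the centred Gaussian of variance [s ^+ 2], so [|x|] times this
    Gaussian is at most a multiple of the one of variance [2 * s ^+ 2]. The factor [1 + 4 * s ^+ 2]
    makes [1 + y <= expR y] sufficient. *)
Lemma norm_le_expR_sqr (x : R) :
  `|x| <= (1 + 4 * s ^+ 2) * expR (x ^+ 2 / (s ^+ 2 * 2 *+ 2)).
Proof.
have s20 : 0 < s ^+ 2 by rewrite exprn_even_gt0.
apply: (@le_trans _ _ (1 + x ^+ 2)).
  by rewrite -[x ^+ 2]real_normK ?num_real//; have := sqr_ge0 (`|x| - 1); nra.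
apply: le_trans (ler_wpM2l _ (expR_ge1Dx _)); last by nra.
have -> : (1 + 4 * s ^+ 2) * (1 + x ^+ 2 / (s ^+ 2 * 2 *+ 2)) =
    1 + x ^+ 2 + (4 * s ^+ 2 + x ^+ 2 / (4 * s ^+ 2)) by field; exact/negP/negP.
have x20 := sqr_ge0 x; have s4 : 0 <= 4 * s ^+ 2 by lra.
by rewrite lerDl addr_ge0// divr_ge0.
Qed.

Lemma integrable_abs_normal_pdf :
  mu.-integrable setT (fun x => (`|x| * f x)%:E).
Proof.
pose r := s * Num.sqrt 2; pose C :=
  (1 + 4 * s ^+ 2) * normal_peak s / normal_peak r.
have r0 : r != 0 by rewrite mulf_neq0// gt_eqF// sqrtr_gt0.
apply: (@le_integrable _ _ R mu setT measurableT _
  (fun x : R => (C * normal_pdf 0 r x)%:E)) => //.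
- apply/measurable_EFinP/measurable_funM; last exact: measurable_normal_pdf.
  exact: normr_measurable.
- move=> x _; rewrite lee_fin normrM normr_id; apply: le_trans (ler_norm _).
  rewrite ger0_norm ?normal_pdf_ge0//.
  rewrite !normal_pdfE// /C -!mulrA mulrCA [leRHS]mulrCA ler_pM2l
    ?normal_peak_gt0//.
  rewrite mulKf ?gt_eqF ?normal_peak_gt0//.
  rewrite /normal_fun subr0 /r exprMn sqr_sqrtr//.
  set e2 := expR (- x ^+ 2 / (s ^+ 2 * _ *+ 2)).
  have -> : expR (- x ^+ 2 / (s ^+ 2 *+ 2)) = e2 * e2.
    by rewrite /e2 -expRD; congr expR; field; exact/negP/negP.
  rewrite mulrA ler_pM2r ?expR_gt0// /e2 mulNr expRN ler_pdivrMr ?expR_gt0//.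
  exact: norm_le_expR_sqr.
- under eq_fun do rewrite EFinM.
  by apply: integrableZl => //; exact: integrable_normal_pdf.
Qed.

Section charfun.
Variable th : R.
(** The phase [th] lets one formula cover sines as well, which are cosines shifted by [pi / 2]. The
    derivative of [c a x] in [a] is [- S a x]. *)
Let c (a x : R) := cos (th + a * x) * f x.
Let S (a x : R) := x * sin (th + a * x) * f x.

Let cont_lin (a : R) : continuous (fun x : R => th + a * x).
Proof.
by move=> x; apply: cvgD; [exact: cvg_cst|apply: cvgM;
  [exact: cvg_cst|exact: cvg_id]].
Qed.

Let cont_c a : continuous (c a).
Proof.
move=> x; apply: cvgM; last exact: continuous_normal_pdf.
by apply: continuous_comp; [exact: cont_lin|exact: continuous_cos].
Qed.

Let cont_S a : continuous (S a).
Proof.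
move=> x; apply: cvgM; last exact: continuous_normal_pdf.
apply: cvgM; first exact: cvg_id.
by apply: continuous_comp; [exact: cont_lin|exact: continuous_sin].
Qed.

Let int_c a : mu.-integrable setT (EFin \o c a).
Proof.
apply: (@le_integrable _ _ R mu setT measurableT _
  (fun x : R => (normal_pdf 0 s x)%:E)) => //.
- by apply/measurable_EFinP; apply: continuous_measurable_fun; exact: cont_c.
- move=> x _; rewrite lee_fin normrM ler_piMl//; exact: cos_max.
- exact: integrable_normal_pdf.
Qed.

Let int_S a : mu.-integrable setT (EFin \o S a).
Proof.
apply: (@le_integrable _ _ R mu setT measurableT _
  (fun x : R => (`|x| * normal_pdf 0 s x)%:E)) => //.
- by apply/measurable_EFinP; apply: continuous_measurable_fun; exact: cont_S.
- move=> x _; rewrite lee_fin !normrM normr_id ler_wpM2r// ler_piMr//.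
  exact: sin_max.
- exact: integrable_abs_normal_pdf.
Qed.

(** Gaussian integration by parts: [k] below is the derivative of [sin (th + a * x) * f x], which
    vanishes at infinity. *)
Let Rint_S a : \int[mu]_x S a x = s ^+ 2 * a * \int[mu]_x c a x.
Proof.
have s20 : s ^+ 2 != 0 by rewrite expf_neq0.
pose k x := a * c a x - (s ^+ 2)^-1 * S a x.
have intk : mu.-integrable setT (EFin \o k).
  rewrite /k /comp; under eq_fun do rewrite EFinB !EFinM.
  by apply: integrableB => //; apply: integrableZl => //;
    [exact: int_c|exact: int_S].
have : (\int[mu]_x (k x)%:E = 0)%E.
  apply: (@integral_derive_eq0 (fun x => sin (th + a * x) * f x)) => //.
  - move=> x; have := is_derive_normal_pdf x => df.
    have dl : is_derive x 1 (fun x : R => th + a * x) a.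
      have -> : (fun x : R => th + a * x) = (cst th + a \*: id)%R by [].
      by apply: is_derive_eq; rewrite add0r /GRing.scale/= mulr1.
    have ds := @is_derive1_comp _ sin _ _ _ _ _ dl.
    have -> : (fun x => sin (th + a * x) * f x) = (sin \o (fun x : R =>
      th + a * x)) * f by [].
    apply: is_derive_eq.
    rewrite /k /c /S /GRing.scale/=; field.
    exact/negP/negP.
  - move=> x; apply: cvgB; (apply: cvgM; first exact: cvg_cst);
      [exact: cont_c|exact: cont_S].
  - apply: norm_cvg0.
    apply: (@squeeze_cvgr _ _ _ _ (cst 0) (fun n => 2 * f n%:R)).
    + apply: nearW => n; rewrite normr_ge0/= mulr_natl mulr2n.
      apply: le_trans (ler_normB _ _) _; rewrite !normrM.
      have fN : f (- n%:R) = f n%:R by rewrite normal_pdfE// /normal_fun !subr0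
        sqrrN.
      by rewrite fN (ger0_norm (normal_pdf_ge0 _ _ _)) lerD// ler_piMl
        ?normal_pdf_ge0// sin_max.
    + exact: cvg_cst.
    + rewrite -[X in _ --> X](mulr0 2).
      exact: (@cvgM _ _ _ _ (cst 2) _ _ _ (cvg_cst _) normal_pdf_cvg0).
move=> k0; have : \int[mu]_x k x = 0 by rewrite /Rintegral k0.
rewrite /k RintegralB//; last 2 first.
- by rewrite /comp; under eq_fun do rewrite EFinM; apply: integrableZl => //;
    exact: int_c.
- by rewrite /comp; under eq_fun do rewrite EFinM; apply: integrableZl => //;
    exact: int_S.
rewrite !RintegralZl//.
by move/eqP; rewrite subr_eq0 => /eqP h; rewrite -mulrA h mulVKf.
Qed.

(** Differentiation under the integral, dominated by [|x| * f x]; [Rint_S] then turns the derivative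
    into a linear differential equation in [a]. *)
Let is_derive_Rint_c (a : R) : is_derive a 1 (fun a => \int[mu]_x c a x)
  (- (s ^+ 2 * a * \int[mu]_x c a x)).
Proof.
have d1 (b y : R) : is_derive b 1 (c^~ y) (- S b y).
  have dl : is_derive b 1 (fun a : R => th + a * y) y.
    have -> : (fun a : R => th + a * y) = (cst th + y \*: id)%R.
      by apply/funext => z /=; rewrite mulrC.
    by apply: is_derive_eq; rewrite add0r /GRing.scale/= mulr1.
  have ds := @is_derive1_comp _ cos _ _ _ _ _ dl.
  have -> : c^~ y = f y \*: (cos \o (fun a : R => th + a * y)).
    by apply/funext => z; rewrite /c /= mulrC.
  by apply: is_derive_eq; rewrite /S /GRing.scale/=; ring.
have pE b y : partial1of2 c b y = - S b y by rewrite partial1of2E derive_val.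
have aI : `]a - 1, a + 1[%classic a.
  by rewrite /= in_itv/= ltrBlDr ltrDl ltr01.
have := @cvg_differentiation_under_integral R _ _ mu c setT measurableT
  a (a - 1) (a + 1) aI (fun b _ => int_c b) _ (fun y => `|y| * f y) _
  integrable_abs_normal_pdf _.
move=> /(_ _ _ _) h.
have {}h : h^-1 *: (((fun a => \int[mu]_x c a x) \o shift a) (h *: (1 : R)) -
    \int[mu]_x c a x) @[h --> 0^'] --> - (s ^+ 2 * a * \int[mu]_x c a x).
  rewrite -Rint_S.
  have -> : - (\int[mu]_x S a x) = \int[mu]_y partial1of2 c a y.
    under [RHS]eq_Rintegral do rewrite pE -mulN1r.
    by rewrite RintegralZl ?mulN1r//; exact: int_S.
  under eq_fun do rewrite /= scaler1.
  apply: h.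
  - by move=> b y _ _; exact: ex_derive.
  - by move=> y; rewrite mulr_ge0 ?normal_pdf_ge0.
  - move=> b y _ _; rewrite pE normrN !normrM (ger0_norm (normal_pdf_ge0 _ _
      _)).
    by rewrite ler_wpM2r ?normal_pdf_ge0// ler_piMr// sin_max.
apply: DeriveDef; last exact/cvg_lim.
by apply/cvg_ex; eexists; exact: h.
Qed.

(** [J] is the integral times the integrating factor of its differential equation, hence constant;
    at 0 it is [cos th] times the total mass 1. *)
Lemma Rintegral_cos_normal_pdf (a : R) :
  \int[mu]_x (cos (th + a * x) * f x) = cos th * expR (- (s ^+ 2 * a ^+ 2 / 2)).
Proof.
pose J (a : R) := (\int[mu]_x c a x) * expR (s ^+ 2 * a ^+ 2 / 2).
suff JE : J a = J 0.
  have := JE; rewrite /J {2}/c; under [X in _ =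
    X * _ -> _]eq_Rintegral do rewrite mul0r addr0.
  rewrite RintegralZl//; last exact: integrable_normal_pdf.
  rewrite {2}/Rintegral integral_normal_pdf/= mulr1 expr0n/= mulr0 mul0r expR0
    mulr1.
  by move=> <-; rewrite -[RHS]mulrA -expRD subrr expR0 mulr1.
apply: is_derive_0_is_cst => b.
have := is_derive_Rint_c b => dI.
have dq : is_derive b 1 (fun a : R => s ^+ 2 * a ^+ 2 / 2) (s ^+ 2 * b).
  have -> : (fun a : R => s ^+ 2 * a ^+ 2 / 2) = (s ^+ 2 / 2) \*: (id ^+ 2).
    by apply/funext => z; rewrite mulrAC.
  by apply: is_derive_eq; rewrite /GRing.scale/=; field.
have -> : J = (fun a => \int[mu]_x c a x) * (expR \o (fun a =>
  s ^+ 2 * a ^+ 2 / 2)).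
  by [].
by apply: is_derive_eq; rewrite /GRing.scale/=; ring.
Qed.

End charfun.

Lemma Rintegral_cos_normal_prob (th a : R) :
  \int[normal_prob 0 s]_x cos (th + a * x) =
  cos th * expR (- (s ^+ 2 * a ^+ 2 / 2)).
Proof.
rewrite -Rintegral_cos_normal_pdf; congr fine.
apply: (integral_density (@measurable_id _ _ setT)) => //.
- exact: measurable_normal_pdf.
- exact: normal_pdf_ge0.
- apply: continuous_measurable_fun => x; apply: continuous_comp;
    last exact: continuous_cos.
  by apply: cvgD; [exact: cvg_cst|apply: cvgM; [exact: cvg_cst|exact: cvg_id]].
Qed.
End pdf.
End normal_charfun.

(** * Independent normal variables *)

Lemma measurable_cos (R : realType) : measurable_fun setT (@cos R).
Proof. by apply: continuous_measurable_fun; exact: continuous_cos. Qed.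

Lemma measurable_sin (R : realType) : measurable_fun setT (@sin R).
Proof. by apply: continuous_measurable_fun; exact: continuous_sin. Qed.

Lemma bounded_integrable d (T : measurableType d) (R : realType)
    (m : {finite_measure set T -> \bar R}) (f : T -> R) (C : R) :
  measurable_fun setT f -> (forall x, `|f x| <= C) ->
  m.-integrable setT (EFin \o f).
Proof.
move=> mf fC; apply: measurable_bounded_integrable => //.
  by rewrite ltey_eq; apply/orP; left; exact: fin_num_measure.
exists C; split; first by rewrite num_real.
by move=> M CM x _; apply: le_trans (ltW CM); exact: fC.
Qed.

Section independence.
Context d (T : measurableType d) (R : realType).
Variable M : probability T R.

(** The hypotheses say that the conditional mean of [V] given [X] is the constant [k]. Independence
    enters in this form: [V] will be a cosine of the other coordinates restricted to a box. *)
Lemma Rintegral_indep (X : T -> R) (N : probability (measurableTypeR R) R)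
    (V : T -> R) (k : R) :
  measurable_fun setT X -> measurable_fun setT V -> (forall x, `|V x| <= 1) ->
  (forall A, measurable A -> M (X @^-1` A) = N A) ->
  (forall A, measurable A -> (\int[M]_(x in X @^-1` A) (V x)%:E =
    k%:E * N A)%E) ->
  forall h : R -> R, measurable_fun setT h -> (forall x, `|h x| <= 1) ->
  \int[M]_x (h (X x) * V x) = k * \int[N]_x h x.
Proof.
move=> mX mV V1 XN VN h mh h1.
have mhX : measurable_fun setT (h \o X) by exact: measurableT_comp.
have mXA A : measurable A -> measurable (X @^-1` A).
  by move=> mA; rewrite -[X in measurable X]setTI; exact: mX.
have intV : M.-integrable setT (EFin \o V) by exact: bounded_integrable V1.
have inthX : M.-integrable setT (EFin \o (h \o X)).
  by apply: (@bounded_integrable _ _ _ _ _ 1) => // x; exact: h1.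
have inthXV : M.-integrable setT (EFin \o (fun x => h (X x) * V x)).
  apply: (@bounded_integrable _ _ _ _ _ 1); first exact: measurable_funM.
  by move=> x; rewrite normrM -[leRHS]mul1r ler_pM.
(* The whole space as event shows that [k] is the mean of [V], so its absolute value is at most
   1. *)
have k1 : 0 < k + 2.
  have /eqP := VN setT measurableT.
  rewrite preimage_setT probability_setT mule1 => kE.
  have : (`|k%:E| <= 1)%E.
    rewrite -(eqP kE).
    apply: le_trans (le_abse_integral _ _ _) _ => //.
      exact/measurable_EFinP.
    apply: (@le_trans _ _ (\int[M]_x (cst 1 x))%E).
      apply: ge0_le_integral => //.
        by apply/measurable_EFinP; exact: measurableT_comp.
      by move=> x _; rewrite /= lee_fin.
    by rewrite integral_cst// mul1e probability_le1.
  by rewrite /= lee_fin ler_norml => /andP[? _]; lra.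
(* Unlike V, the function (V + 2) / (k + 2) is a probability density. *)
pose g x := (V x + 2) / (k + 2).
have H : (\int[N]_x (h x)%:E = \int[M]_x (h (X x) * g x)%:E)%E.
  apply: (@integral_density _ _ T (measurableTypeR R) R M N X mX) => //.
  - by apply: measurable_funM => //; exact: measurable_funD.
  - move=> x; rewrite divr_ge0// ?(ltW k1)//.
    by have := V1 x; rewrite ler_norml => /andP[? _]; lra.
  - move=> A mA; rewrite /g; under eq_integral do rewrite mulrC EFinM EFinD.
    have iV : M.-integrable (X @^-1` A) (EFin \o V).
      by apply: (integrableS measurableT) => //; exact: mXA.
    have i2 : M.-integrable (X @^-1` A) (EFin \o cst 2).
      by apply: finite_measure_integrable_cst; exact: mXA.
    have mA' := mXA A mA.
    rewrite integralZl//; last exact: integrableD.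
    rewrite integralD// VN// integral_cst//.
    transitivity (((k + 2)^-1)%:E * (k%:E * N A + 2%:E * N A))%E; last first.
      by congr (_ * (_ + _ * _))%E; exact/esym/XN.
    rewrite -muleDl ?fin_num_measure// muleA -!EFinD -EFinM mulVf ?mul1e//.
    by rewrite gt_eqF.
have HM : \int[N]_x h x = \int[M]_x h (X x).
  congr fine; have := @integral_density _ _ T (measurableTypeR R) R M N X mX
    (cst 1) h.
  move=> ->//.
  - by apply: eq_integral => x _; rewrite mulr1.
  - move=> A mA; transitivity (\int[M]_(x in X @^-1` A) cst 1%E x)%E;
      last by [].
    by rewrite integral_cst ?mul1e; [exact/esym/XN|exact: mXA].
have int2 : M.-integrable setT (EFin \o (fun x => 2 * h (X x))).
  by rewrite /comp; under eq_fun do rewrite EFinM; exact: integrableZl.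
have : (k + 2) * \int[N]_x h x = \int[M]_x (h (X x) * V x + 2 * h (X x)).
  rewrite {1}/Rintegral H -[fine _]/(Rintegral M setT (fun x => h (X x) * g x)).
  rewrite -RintegralZl//.
    by apply: eq_Rintegral => x _; rewrite /g; field; rewrite gt_eqF.
  have g_ x : (h (X x) * g x) = (k + 2)^-1 * (h (X x) * V x + 2 * h (X x)).
    by rewrite /g; field; rewrite gt_eqF.
  rewrite /comp; under eq_fun do rewrite g_ EFinM EFinD.
  by apply: integrableZl => //; exact: integrableD.
rewrite RintegralD//.
rewrite RintegralZl// -HM; lra.
Qed.

Section independent_normals.
Variables (I : finType) (X : I -> T -> R) (s : I -> R).
Hypothesis mX : forall i, measurable_fun setT (X i).
Hypothesis s0 : forall i, s i != 0.
Let box (B : I -> set R) := [set w | forall i, B i (X i w)].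
Hypothesis MX : forall B : I -> set R, (forall i, measurable (B i)) ->
  M [set w | forall i, B i (X i w)] = (\prod_i normal_prob 0 (s i) (B i))%E.

Let upd (B : I -> set R) j A i := if i == j then A else B i.

Let m_upd B j A : (forall i, measurable (B i)) -> measurable A ->
  forall i, measurable (upd B j A i).
Proof. by move=> mB mA i; rewrite /upd; case: ifP. Qed.

Let m_box B : (forall i, measurable (B i)) -> measurable (box B).
Proof.
move=> mB; rewrite (_ : box B = \bigcap_(i in [set: I]) (X i @^-1` B i)).
  apply: fin_bigcap_measurable => // i _.
  by rewrite -[X in measurable X]setTI; exact: mX.
by apply/seteqP; split => w h i; [move=> _|]; exact: h.
Qed.

Let M_upd B j A : (forall i, measurable (B i)) -> B j = setT -> measurable A ->
  M (box (upd B j A)) = (normal_prob 0%R (s j) A * M (box B))%E.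
Proof.
move=> mB BjT mA; rewrite !MX//; last exact: m_upd.
rewrite (bigD1 j)//= [in RHS](bigD1 j)//= BjT probability_setT mul1e.
rewrite {1}/upd eqxx; congr (_ * _)%E; apply: eq_bigr => i ij.
by rewrite /upd (negbTE ij).
Qed.

Let M_X j A : measurable A -> M (X j @^-1` A) = normal_prob 0%R (s j) A.
Proof.
move=> mA; have := @M_upd (fun=> setT) j A (fun=> measurableT) erefl mA.
rewrite (_ : box (fun=> setT) = setT); last by apply/seteqP; split.
rewrite probability_setT mule1 => <-; congr (M _).
apply/seteqP; split => w /=; first by move=> Aw i; rewrite /upd;
  case: eqP => // ->.
by move=> /(_ j); rewrite /upd eqxx.
Qed.

Let V (r : seq I) (a : I -> R) (B : I -> set R) th w :=
  \1_(box B) w * cos (th + \sum_(i <- r) a i * X i w).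

Let mV r a B th : (forall i, measurable (B i)) ->
  measurable_fun setT (V r a B th).
Proof.
move=> mB; apply: measurable_funM; first exact/measurable_indic/m_box.
apply: (measurableT_comp (@measurable_cos R)).
apply: measurable_funD => //; apply: measurable_sum => i.
by apply: measurable_funM => //; exact: mX.
Qed.

Let V1 r a B th w : `|V r a B th w| <= 1.
Proof.
rewrite normrM -[leRHS]mul1r ler_pM ?cos_max// indicE.
by case: (_ \in _); rewrite ?normr1 ?normr0.
Qed.

(** Induction on the coordinates inside the cosine. The box stays free because the induction
    hypothesis for [B] with [A] put at [j] is exactly what [Rintegral_indep] asks of [X j]; the
    phase stays free because expanding the cosine produces a sine, that is, the phase
    [th - pi / 2]. *)
Let Rint_V (r : seq I) (a : I -> R) : uniq r ->
  forall th B, (forall i, measurable (B i)) -> (forall i,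
    i \in r -> B i = setT) ->
  \int[M]_w V r a B th w =
  cos th * expR (- (\sum_(i <- r) s i ^+ 2 * a i ^+ 2) / 2) * fine (M (box B)).
Proof.
elim: r => [_ th B mB _|j r IH /= /andP[jr ur] th B mB BT].
  rewrite /V; under eq_Rintegral do rewrite big_nil addr0 mulrC.
  rewrite RintegralZl//; last first.
    apply: (@bounded_integrable _ _ _ _ _ 1);
      first exact/measurable_indic/m_box.
    by move=> x; rewrite indicE; case: (_ \in _); rewrite ?normr1 ?normr0.
  rewrite /Rintegral integral_indic//; last exact: m_box.
  by rewrite setIT big_nil oppr0 mul0r expR0 mulr1.
have BjT : B j = setT by apply: BT; rewrite mem_head.
pose k t := cos t * expR (- (\sum_(i <- r) s i ^+ 2 * a i ^+ 2) / 2) * fine (M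
  (box B)).
have Vk t A : measurable A ->
    (\int[M]_(x in X j @^-1` A) (V r a B t x)%:E =
      (k t)%:E * normal_prob 0%R (s j) A)%E.
  move=> mA; have mU := m_upd j mB mA.
  transitivity (\int[M]_x (V r a (upd B j A) t x)%:E)%E.
    rewrite integral_mkcond; apply: eq_integral => w _.
    rewrite patchE /V !indicE.
    have -> : (w \in box (upd B j A)) = (w \in X j @^-1` A) && (w \in box B).
      apply/idP/andP; rewrite !inE.
        move=> h; split; first by have := h j; rewrite /upd eqxx.
        by move=> i; have := h i; rewrite /upd; case: eqP => // ->; rewrite BjT.
      by move=> [Aw Bw] i; rewrite /upd; case: eqP => // ->.
    by case: ifP => //= _; rewrite mul0r.
  rewrite -[LHS]fineK; last first.
    apply: integrable_fin_num => //.
    by apply: (@bounded_integrable _ _ _ _ _ 1) => //; exact: mV.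
  rewrite -[fine _]/(Rintegral M setT (V r a (upd B j A) t)) IH//; last first.
    move=> i ir; rewrite /upd; case: eqP => [ij|_]; first by move: jr;
      rewrite -ij ir.
    by apply: BT; rewrite in_cons ir orbT.
  rewrite M_upd// fineM ?fin_num_measure//; last exact: m_box.
  by rewrite mulrCA EFinM fineK ?fin_num_measure// muleC.
have H t := @Rintegral_indep (X j) (normal_prob 0 (s j)) _ _ (mX j) (mV r a t
  mB) (V1 r a B t) (@M_X j) (Vk t).
have ccos : measurable_fun setT (fun x => cos (a j * x)).
  by apply: (measurableT_comp (@measurable_cos R)); exact: measurable_funM.
have csin : measurable_fun setT (fun x => sin (a j * x)).
  by apply: (measurableT_comp (@measurable_sin R)); exact: measurable_funM.
transitivity (\int[M]_w (cos (a j * X j w) * V r a B th w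
    - sin (a j * X j w) * V r a B (th - pi / 2) w)).
  apply: eq_Rintegral => w _; rewrite /V big_cons addrCA cosD.
  by rewrite [th - _ + _]addrAC cosBpihalf; ring.
have bint (f : R -> R) t : measurable_fun setT f -> (forall x, `|f x| <= 1) ->
    M.-integrable setT (EFin \o (fun w => f (X j w) * V r a B t w)).
  move=> mf f1; apply: (@bounded_integrable _ _ _ _ _ 1).
    by apply: measurable_funM; [exact: (measurableT_comp mf (mX j))|exact: mV].
  by move=> w; rewrite normrM -[leRHS]mul1r ler_pM.
rewrite RintegralB//; last 2 first.
- by apply: (bint (fun x => cos (a j * x))) => // x; exact: cos_max.
- by apply: (bint (fun x => sin (a j * x))) => // x; exact: sin_max.
rewrite (H th (fun x => cos (a j * x)))//; last by move=> x; exact: cos_max.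
rewrite (H (th - pi / 2) (fun x => sin (a j * x)))//; last by move=> x;
  exact: sin_max.
have -> : \int[normal_prob 0 (s j)]_x cos (a j * x) =
  expR (- (s j ^+ 2 * a j ^+ 2 / 2)).
  have := @Rintegral_cos_normal_prob R (s j) (s0 j) 0 (a j).
  by under eq_Rintegral do rewrite add0r; rewrite cos0 mul1r.
(* A sine is a cosine of phase [- (pi / 2)], and the factor [cos (- (pi / 2))] is 0. *)
have -> : \int[normal_prob 0 (s j)]_x sin (a j * x) = 0.
  have := @Rintegral_cos_normal_prob R (s j) (s0 j) (- (pi / 2)) (a j).
  under eq_Rintegral do rewrite addrC cosBpihalf.
  by rewrite cosN cos_pihalf mul0r.
rewrite mulr0 subr0 /k big_cons.
set q := \sum_(_ <- r) _; set p := s j ^+ 2 * _.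
have -> : expR (- (p + q) / 2) = expR (- q / 2) * expR (- (p / 2)).
  by rewrite -expRD; congr expR; lra.
by ring.
Qed.

Lemma charfun_independent_normals (a : I -> R) :
  \int[M]_w cos (\sum_i a i * X i w) =
    expR (- (\sum_i s i ^+ 2 * a i ^+ 2) / 2).
Proof.
have := @Rint_V (index_enum I) a (index_enum_uniq I) 0 (fun=> setT)
  (fun=> measurableT) (fun _ _ => erefl).
rewrite (_ : box (fun=> setT) = setT); last by apply/seteqP; split.
rewrite probability_setT mulr1 cos0 mul1r => <-.
by apply: eq_Rintegral => w _; rewrite /V add0r indicE mem_set// mul1r.
Qed.

Lemma cos_correlation_ge0 (a b : I -> R) :
  (\int[M]_w cos (\sum_i a i * X i w)) * (\int[M]_w cos (\sum_i b i * X i w)) <=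
  \int[M]_w (cos (\sum_i a i * X i w) * cos (\sum_i b i * X i w)).
Proof.
have mcosl (c : I -> R) : M.-integrable setT
    (EFin \o (fun w => cos (\sum_i c i * X i w))).
  apply: (@bounded_integrable _ _ _ _ _ 1); last by move=> w; exact: cos_max.
  apply: (measurableT_comp (@measurable_cos R)).
  by apply: measurable_sum => i; apply: measurable_funM => //; exact: mX.
have -> : \int[M]_w (cos (\sum_i a i * X i w) * cos (\sum_i b i * X i w)) =
    2^-1 * ((\int[M]_w cos (\sum_i (a i + b i) * X i w)) +
            \int[M]_w cos (\sum_i (a i - b i) * X i w)).
  have iD := integrableD measurableT (mcosl (fun i =>
    a i + b i)) (mcosl (fun i => a i - b i)).
  rewrite -RintegralD//.
  rewrite -RintegralZl//.
  apply: eq_Rintegral => w _.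
  have -> : \sum_i (a i + b i) * X i w =
    \sum_i a i * X i w + \sum_i b i * X i w.
    by rewrite -big_split/=; apply: eq_bigr => i _; rewrite mulrDl.
  have -> : \sum_i (a i - b i) * X i w =
    \sum_i a i * X i w - \sum_i b i * X i w.
    by rewrite -sumrB; apply: eq_bigr => i _; rewrite mulrBl.
  by rewrite cosD cosB; field.
pose q c := \sum_i s i ^+ 2 * c i ^+ 2.
have cfE c : \int[M]_w cos (\sum_i c i * X i w) = expR (- q c / 2).
  exact: charfun_independent_normals.
rewrite (cfE a) (cfE b) (cfE (fun i => a i + b i)) (cfE (fun i => a i - b i)).
have qE : q a + q b = 2^-1 * (q (fun i => a i + b i) + q (fun i => a i - b i)).
  by rewrite /q -!big_split/= mulr_sumr; apply: eq_bigr => i _; field.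
(* Square roots of the two characteristic functions on the right, hence 4 in place of 2. By [qE]
   their product is the left-hand side, and [2 x y <= x^2 + y^2] remains. *)
pose x := expR (- q (fun i => a i + b i) / 4).
pose y := expR (- q (fun i => a i - b i) / 4).
have -> : expR (- q (fun i => a i + b i) / 2) = x ^+ 2.
  by rewrite expr2 -expRD; congr expR; lra.
have -> : expR (- q (fun i => a i - b i) / 2) = y ^+ 2.
  by rewrite expr2 -expRD; congr expR; lra.
have -> : expR (- q a / 2) * expR (- q b / 2) = x * y.
  by rewrite -!expRD; congr expR; lra.
by have := sqr_ge0 (x - y); lra.
Qed.

End independent_normals.
End independence.

(** * Linear functionals of the Brownian increments *)

Section brownian.
Context (R : realType) (P : probability (path_on [set: R]) R).
Hypothesis hP : brownian_law P.
Variable T : R.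
Hypothesis T0 : 0 < T.
Local Notation Om := (path_on (window T)).
Local Notation M := (restr_law P (window T)).

(** The triples are coefficient, time and coordinate. With all increments based at [- T], addition
    of functionals is concatenation of lists. *)
Definition linfunc (L : seq (R * R * 'I_3)) (w : cpath R) : R :=
  \sum_(x <- L) x.1.1 * (w x.1.2 - w (- T)) 0 x.2.

Definition in_window (L : seq (R * R * 'I_3)) :=
  forall x, x \in L -> window T x.1.2.

Lemma window_left : window T (- T).
Proof. by apply/windowP; rewrite lexx/= ge0_cp ?ltW. Qed.

Lemma measurable_linfunc L : in_window L ->
  measurable_fun setT (linfunc L : Om -> R).
Proof.
move=> LT.
(* Measurability of a sum is asked of every summand, also for indices outside [L], whose times may
   leave the window; the test replaces these by 0. *)
rewrite (_ : linfunc L = fun w : cpath R => \sum_(x <- L)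
    if x \in L then x.1.1 * (w x.1.2 - w (- T)) 0 x.2 else 0); last first.
  by apply/funext => w; apply: eq_big_seq => x ->.
apply: measurable_sum => x; case: (boolP (x \in L)) => [xL|_];
  last exact: measurable_cst.
apply: measurable_funM => //; apply: measurable_incr; last exact: LT.
exact: window_left.
Qed.

Lemma linfunc_cat L1 L2 w : linfunc (L1 ++ L2) w = linfunc L1 w + linfunc L2 w.
Proof. exact: big_cat. Qed.

Definition linscale (c : R) (L : seq (R * R * 'I_3)) :=
  [seq (c * x.1.1, x.1.2, x.2) | x <- L].

Lemma linfunc_scale c L w : linfunc (linscale c L) w = c * linfunc L w.
Proof.
rewrite /linfunc big_map mulr_sumr; apply: eq_bigr => x _ /=.
by rewrite mulrA.
Qed.

Lemma in_window_cat L1 L2 : in_window L1 -> in_window L2 ->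
  in_window (L1 ++ L2).
Proof. by move=> h1 h2 x; rewrite mem_cat => /orP[/h1|/h2]. Qed.

Lemma in_window_scale c L : in_window L -> in_window (linscale c L).
Proof. by move=> h x /mapP[y /h yT ->]. Qed.

Lemma linfunc_increments (n : nat) (t : nat -> R) (L : seq (R * R * 'I_3)) :
  (exists2 j, (j <= n)%N & t j = - T) ->
  (forall x, x \in L -> exists2 j, (j <= n)%N & t j = x.1.2) ->
  exists a : 'I_n * 'I_3 -> R, forall w, linfunc L w =
    \sum_p a p * (w (t p.1.+1) - w (t p.1)) 0 p.2.
Proof.
move=> [j0 j0n tj0]; elim: L => [_|x L IH xL].
  exists (fun=> 0) => w; rewrite /linfunc big_nil big1// => p _.
  by rewrite mul0r.
have [y yL|a aE] := IH; first by apply: xL; rewrite in_cons yL orbT.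
have [j jn tj] := xL x (mem_head _ _).
(* [w (t j) - w (t j0)] telescopes; the difference of the two indicators selects the steps between
   [j0] and [j], with sign -1 if [j < j0]. *)
exists (fun p => a p + (p.2 == x.2)%:R * x.1.1 * ((p.1 < j)%N%:R - (p.1 <
  j0)%N%:R)) => w.
rewrite /linfunc big_cons -/(linfunc L w) aE.
under [RHS]eq_bigr do rewrite mulrDl.
rewrite big_split/= addrC; congr (_ + _).
have tel m : (m <= n)%N -> (w (t m) - w (t 0%N)) 0 x.2 =
    \sum_(k < n) (k < m)%N%:R * (w (t k.+1) - w (t k)) 0 x.2.
  move=> mn; rewrite -(big_mkord xpredT (fun k =>
    (k < m)%N%:R * (w (t k.+1) - w (t k)) 0 x.2)).
  rewrite (big_cat_nat (n := m))//= [X in _ = _ + X]big1_seq ?addr0; last first.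
    by move=> k; rewrite mem_index_iota /= => /andP[mk _];
      rewrite ltnNge mk mul0r.
  have /= E := telescope_sumr (fun k => (w (t k) : 'rV[R]_3) 0 x.2) (leq0n m).
  rewrite !mxE -E.
  by apply: eq_big_nat => k /andP[_ km]; rewrite km mul1r !mxE.
have -> : (w x.1.2 - w (- T)) 0 x.2 = (w (t j) - w (t 0%N)) 0 x.2
    - (w (t j0) - w (t 0%N)) 0 x.2 by rewrite tj tj0 !mxE; lra.
rewrite !tel// -sumrB mulr_sumr -(pair_big xpredT xpredT
  (fun (k : 'I_n) (i : 'I_3) => (i == x.2)%:R * x.1.1 * ((k < j)%N%:R - (k <
    j0)%N%:R)
    * (w (t k.+1) - w (t k)) 0 i))/=.
apply: eq_bigr => k _; rewrite (bigD1 x.2)//= eqxx big1 ?addr0; last first.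
  by move=> i /negbTE ->; rewrite !mul0r.
by rewrite mul1r -mulrA; congr (_ * _); rewrite mulrBl.
Qed.

(** [brownian_law] speaks of strictly increasing times, hence the sorting without repetition. The
    base point [- T] is added to the list, which is then nonempty and has one step fewer than
    points. *)
Lemma linfunc_partition (s : seq R) : (forall x, x \in s -> window T x) ->
  exists n (t : nat -> R), [/\ (forall k : 'I_n, t k < t k.+1),
    (forall k, (k <= n)%N -> window T (t k)),
    (exists2 j, (j <= n)%N & t j = - T) &
    (forall x, x \in s -> exists2 j, (j <= n)%N & t j = x)].
Proof.
move=> sT; pose S := sort <=%O (undup (- T :: s)).
have memS x : (x \in S) = (x \in - T :: s) by rewrite mem_sort mem_undup.
have S0 : (0 < size S)%N.
  by rewrite lt0n size_eq0; apply/eqP => S0; have := memS (- T);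
    rewrite S0 mem_head.
have sS : sorted <%O S by rewrite sort_lt_sorted undup_uniq.
exists (size S).-1, (nth 0 S); split.
- move=> k; apply: (sorted_ltn_nth lt_trans 0 sS); rewrite ?inE//.
  + by rewrite (leq_trans (ltn_ord k))// leq_pred.
  + by rewrite -[ltnRHS]prednK// ltnS.
- move=> k kS; have : nth 0 S k \in S by rewrite mem_nth// -[ltnRHS]prednK.
  by rewrite memS in_cons => /orP[/eqP ->|/sT//]; exact: window_left.
- exists (index (- T) S); last by rewrite nth_index// memS mem_head.
  by rewrite -ltnS prednK// index_mem memS mem_head.
- move=> x xs; exists (index x S);
    last by rewrite nth_index// memS in_cons xs orbT.
  by rewrite -ltnS prednK// index_mem memS in_cons xs orbT.
Qed.

Lemma cos_linfunc_correlation L1 L2 : in_window L1 -> in_window L2 ->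
  (\int[M]_w cos (linfunc L1 w)) * (\int[M]_w cos (linfunc L2 w)) <=
  \int[M]_w (cos (linfunc L1 w) * cos (linfunc L2 w)).
Proof.
move=> w1 w2.
(* A common partition makes both functionals combinations of the same independent increments. *)
have [|n [t [tlt tT t0 tL]]] := @linfunc_partition [seq x.1.2 | x <- L1 ++ L2].
  by move=> _ /mapP[x xL ->]; exact: in_window_cat xL.
have [|a aE] := @linfunc_increments n t L1 t0.
  by move=> x xL; apply: tL; apply/mapP; exists x => //; rewrite mem_cat xL.
have [|b bE] := @linfunc_increments n t L2 t0.
  by move=> x xL; apply: tL; apply/mapP; exists x => //;
    rewrite mem_cat xL orbT.
pose X (p : 'I_n * 'I_3) (w : Om) :=
  ((w : cpath R) (t p.1.+1) - (w : cpath R) (t p.1)) 0 p.2.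
pose s (p : 'I_n * 'I_3) := Num.sqrt (t p.1.+1 - t p.1).
have mX p : measurable_fun setT (X p).
  by apply: measurable_incr; apply: tT => //; exact: ltnW.
have s0 p : s p != 0 by rewrite gt_eqF// sqrtr_gt0 subr_gt0.
have MX (B : 'I_n * 'I_3 -> set R) : (forall p, measurable (B p)) ->
    M [set w | forall p, B p (X p w)] = (\prod_p normal_prob 0 (s p) (B p))%E.
  move=> mB; have := @hP n t (fun k i => B (k, i)) tlt (fun k i => mB (k, i)).
  rewrite (pair_big xpredT xpredT (fun (k : 'I_n) (i : 'I_3) =>
     normal_prob 0 (Num.sqrt (t k.+1 - t k)) (B (k, i))))/=.
  have -> : [set w : cpath R | forall (k : 'I_n) (i : 'I_3),
      B (k, i) ((w (t k.+1) - w (t k)) 0 i)] = [set w | forall p, B p (X p w)].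
    by apply/seteqP; split => w h; [case=> k i; exact: h|move=> k i;
      exact: (h (k, i))].
  by move=> ->; apply: eq_bigr => -[k i] _.
have := @cos_correlation_ge0 _ _ R M _ X s mX s0 MX a b.
have -> : linfunc L1 = (fun w => \sum_p a p * X p w) by exact/funext.
by have -> : linfunc L2 = (fun w => \sum_p b p * X p w) by exact/funext.
Qed.

End brownian.

(** * Mixtures of cosines *)

Section Rfubini.
Context d1 d2 (T1 : measurableType d1) (T2 : measurableType d2) (R : realType).
Variables (m1 : probability T1 R) (m2 : probability T2 R) (F : T1 * T2 -> R) (C
  : R).
Hypotheses (mF : measurable_fun setT F) (FC : forall z, `|F z| <= C).

Let intF : (m1 \x m2)%E.-integrable setT (EFin \o F).
Proof.
apply/integrable12ltyP; first exact/measurable_EFinP.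
apply: (@le_lt_trans _ _ (\int[m1]_x \int[m2]_y (cst C%:E y))%E).
  have mC : measurable_fun setT (fun z => `|(EFin \o F) z|%E).
    by apply: measurableT_comp => //; exact/measurable_EFinP.
  apply: ge0_le_integral => //.
  - by move=> x _; exact: integral_ge0.
  - exact: (measurable_fun_fubini_tonelli_F _ mC).
  - move=> x _; apply: ge0_le_integral => //.
    + exact: (measurableT_comp mC).
    + by move=> y _; rewrite /= lee_fin.
under eq_integral do rewrite integral_cst//.
by rewrite integral_cst// ltey_eq !fin_numM// fin_num_measure.
Qed.

Let int1 x : m2.-integrable setT (EFin \o (fun y => F (x, y))).
Proof. by apply: bounded_integrable; [exact: measurableT_comp|move=> y;
  exact: FC]. Qed.

Let int2 y : m1.-integrable setT (EFin \o (fun x => F (x, y))).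
Proof. by apply: bounded_integrable; [exact: measurableT_comp|move=> x;
  exact: FC]. Qed.

Lemma Rintegral_marginal_integrable :
  m1.-integrable setT (EFin \o (fun x => \int[m2]_y F (x, y))).
Proof.
have := integrable_fubini_F intF; apply: eq_integrable => // x _ /=.
by rewrite fineK// integrable_fin_num//; exact: int1.
Qed.

Lemma Rintegral_exchange :
  \int[m1]_x (\int[m2]_y F (x, y)) = \int[m2]_y (\int[m1]_x F (x, y)).
Proof.
congr fine.
transitivity (\int[m1]_x \int[m2]_y (F (x, y))%:E)%E.
  by apply: eq_integral => x _; rewrite fineK// integrable_fin_num//;
    exact: int1.
rewrite (Fubini intF).
by apply: eq_integral => y _; rewrite fineK// integrable_fin_num//; exact: int2.
Qed.

End Rfubini.

Section gaussian_weights.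
Context (R : realType) (P : probability (path_on [set: R]) R).
Hypothesis hP : brownian_law P.
Variable T : R.
Hypothesis T0 : 0 < T.
Local Notation Om := (path_on (window T)).
Local Notation M := (restr_law P (window T)).
Local Notation linfunc := (@linfunc R T).
Local Notation in_window := (@in_window R T).
Variable L0 : seq (R * R * 'I_3).
Hypothesis L0T : in_window L0.

(** The case of empty [L] is the one wanted in the end; arbitrary [L] is what makes the property
    stable under Gaussian weights. *)
Definition cos_correlated (G : Om -> R) := [/\ measurable_fun setT G,
  (forall w, `|G w| <= 1) &
  forall L, in_window L ->
    (\int[M]_w cos (linfunc L0 w)) * (\int[M]_w (cos (linfunc L w) * G w)) <=
    \int[M]_w (cos (linfunc L0 w) * (cos (linfunc L w) * G w))].

Let mcosl L : in_window L ->
  measurable_fun setT (fun w : Om => cos (linfunc L w)).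
Proof.
move=> LT; apply: (measurableT_comp (@measurable_cos R)).
exact: measurable_linfunc.
Qed.

Lemma cos_correlated_cst1 : cos_correlated (cst 1).
Proof.
split => [//|w|L LT]; first by rewrite normr1.
under [X in _ * X]eq_Rintegral do rewrite mulr1.
under [X in _ <= X]eq_Rintegral do rewrite mulr1.
exact: cos_linfunc_correlation.
Qed.

(** For each fixed value [x] of the normal variable, the product of cosines splits into the cosines
    of [L] plus and minus [x] times [m], to which the property of [G] applies; the inequality is
    then integrated over [x]. *)
Lemma cos_correlated_gauss (G : Om -> R) (m : seq (R * R * 'I_3)) (u : R) :
  cos_correlated G -> in_window m -> cos_correlated (fun w =>
    G w * expR (- (u ^+ 2 * linfunc m w ^+ 2 / 2))).
Proof.
(* The formula for the characteristic function requires a nonzero standard deviation; for [u = 0]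
   the weight is 1. *)
move=> gG mT; have [->|u0] := eqVneq u 0.
  rewrite (_ : (fun w => _) = G)//; apply/funext => w.
  by rewrite expr0n/= !mul0r oppr0 expR0 mulr1.
have [mG G1 hG] := gG.
have mlm := measurable_linfunc T0 mT.
split.
- apply: measurable_funM => //; apply: measurableT_comp => //.
  apply: measurableT_comp => //; apply: measurable_funM => //.
  by apply: measurable_funM => //; exact: measurable_funX.
- move=> w; rewrite normrM -[leRHS]mul1r ler_pM// ger0_norm ?expR_ge0//.
  by rewrite -expR0 ler_expR oppr_le0 divr_ge0// mulr_ge0 ?sqr_ge0.
move=> L LT.
pose N := normal_prob 0 u.
have eE (w : Om) : expR (- (u ^+ 2 * linfunc m w ^+ 2 / 2)) =
  \int[N]_x cos (linfunc m w * x).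
  have := @Rintegral_cos_normal_prob R u u0 0 (linfunc m w).
  by under eq_Rintegral do rewrite add0r; rewrite cos0 mul1r => ->.
have mcx : measurable_fun setT (fun z : measurableTypeR R * Om =>
  cos (linfunc m z.2 * z.1)).
  apply: (measurableT_comp (@measurable_cos R)).
  by apply: measurable_funM => //; exact: measurableT_comp.
have H (V : Om -> R) : measurable_fun setT V -> (forall w, `|V w| <= 1) ->
    \int[M]_w (V w * expR (- (u ^+ 2 * linfunc m w ^+ 2 / 2))) =
    \int[N]_x (\int[M]_w (V w * cos (linfunc m w * x))) /\
    N.-integrable setT (EFin \o (fun x =>
      \int[M]_w (V w * cos (linfunc m w * x)))).
  move=> mV V1.
  pose F (z : measurableTypeR R * Om) := V z.2 * cos (linfunc m z.2 * z.1).
  have mF : measurable_fun setT F.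
    by apply: measurable_funM => //; exact: measurableT_comp.
  have F1 z : `|F z| <= 1 by rewrite normrM -[leRHS]mul1r ler_pM// cos_max.
  split; last exact: (@Rintegral_marginal_integrable _ _ _ _ R N M F 1 mF F1).
  rewrite (@Rintegral_exchange _ _ _ _ R N M F 1 mF F1).
  apply: eq_Rintegral => w _; rewrite eE -RintegralZl//.
  by apply: (@bounded_integrable _ _ _ _ _ 1) => [|x];
    [exact: (measurableT_comp mcx (measurable_pair2 w))|exact: cos_max].
have m1 : measurable_fun setT (fun w : Om => cos (linfunc L w) * G w).
  by apply: measurable_funM => //; exact: mcosl.
have m2 : measurable_fun setT (fun w : Om =>
  cos (linfunc L0 w) * (cos (linfunc L w) * G w)).
  by apply: measurable_funM => //; exact: mcosl.
have b1 w : `|cos (linfunc L w) * G w| <=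
  1 by rewrite normrM -[leRHS]mul1r ler_pM// cos_max.
have b2 w : `|cos (linfunc L0 w) * (cos (linfunc L w) * G w)| <= 1.
  by rewrite normrM -[leRHS]mul1r ler_pM// cos_max.
have [e1 i1] := H _ m1 b1; have [e2 i2] := H _ m2 b2.
under [X in _ * X]eq_Rintegral do rewrite mulrA.
under [X in _ <= X]eq_Rintegral do rewrite [X in _ * X]mulrA mulrA.
rewrite e1 e2 -RintegralZl//; apply: le_Rintegral => //.
  by rewrite /comp; under eq_fun do rewrite EFinM; exact: integrableZl.
move=> x _.
pose Lp := L ++ linscale x m; pose Lm := L ++ linscale (- x) m.
have LpT : in_window Lp by apply: in_window_cat => //; exact: in_window_scale.
have LmT : in_window Lm by apply: in_window_cat => //; exact: in_window_scale.
have cE (w : Om) : cos (linfunc L w) * G w * cos (linfunc m w * x) =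
    2^-1 * (cos (linfunc Lp w) * G w + cos (linfunc Lm w) * G w).
  rewrite !linfunc_cat !linfunc_scale mulNr cosD cosB mulrC [linfunc m w *
    x]mulrC.
  by field.
have iL L' (V : Om -> R) : in_window L' -> measurable_fun setT V -> (forall w,
  `|V w| <= 1) ->
    M.-integrable setT (EFin \o (fun w => cos (linfunc L' w) * V w)).
  move=> L'T mV V1; apply: (@bounded_integrable _ _ _ _ _ 1).
    by apply: measurable_funM => //; exact: mcosl.
  by move=> w; rewrite normrM -[leRHS]mul1r ler_pM// cos_max.
have mbL L' : in_window L' -> measurable_fun setT (fun w : Om =>
  cos (linfunc L' w) * G w) /\
    forall w, `|cos (linfunc L' w) * G w| <= 1.
  move=> L'T; split; first by apply: measurable_funM => //; exact: mcosl.
  by move=> w; rewrite normrM -[leRHS]mul1r ler_pM// cos_max.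
have iD := integrableD measurableT (iL _ _ LpT mG G1) (iL _ _ LmT mG G1).
have [mp bp] := mbL _ LpT; have [mm bm] := mbL _ LmT.
have iDD := integrableD measurableT (iL _ _ L0T mp bp) (iL _ _ L0T mm bm).
under [X in _ * X]eq_Rintegral do rewrite cE.
under [X in _ <= X]eq_Rintegral do rewrite -mulrA cE mulrCA mulrDr.
rewrite RintegralZl// RintegralD//; [|exact: iL|exact: iL].
rewrite RintegralZl// RintegralD//; [|exact: iL|exact: iL].
by rewrite mulrCA ler_pM2l// mulrDr; apply: lerD; exact: hG.
Qed.

End gaussian_weights.

(** * Powers of the action *)

Section tilting.
Context d (Om : measurableType d) (R : realType).
Variables (m : {sigma_finite_measure set Om -> \bar R}) (e : Om -> R) (k : R).
Hypotheses (me : measurable_fun setT e) (e0 : forall w, 0 <= e w) (k0 : 0 <= k).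
Local Open Scope ereal_scope.

(** Used with [e = 1 - cos l] and [k] its mean. Linear in [G] and between integrals of nonnegative
    functions, the inequality allows infinite values and passes through Tonelli. *)
Definition tilt_le (G : Om -> \bar R) :=
  \int[m]_w ((e w)%:E * G w) <= k%:E * \int[m]_w G w.

Let mE : measurable_fun setT (EFin \o e). Proof. exact/measurable_EFinP. Qed.
Let E0 w : 0 <= (e w)%:E. Proof. by rewrite lee_fin. Qed.

Lemma tilt_leZ (c : R) (G : Om -> \bar R) : (0 <= c)%R ->
  measurable_fun setT G -> (forall w, 0 <= G w) ->
  tilt_le G -> tilt_le (fun w => c%:E * G w).
Proof.
move=> c0 mG G0 hG; rewrite /tilt_le.
under eq_integral do rewrite muleCA.
rewrite !ge0_integralZl//; last 2 first.
- exact: emeasurable_funM.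
- by move=> w _; exact: mule_ge0.
by rewrite muleCA; exact: lee_wpmul2l.
Qed.

Lemma tilt_le_integral d' (Y : measurableType d')
    (nu : {sigma_finite_measure set Y -> \bar R}) (H : Om * Y -> \bar R) :
  measurable_fun setT H -> (forall z, 0 <= H z) ->
  (forall y, tilt_le (fun w => H (w, y))) -> tilt_le (fubini_F nu H).
Proof.
move=> mH H0 hH; rewrite /tilt_le /fubini_F.
pose H' (z : Om * Y) := (e z.1)%:E * H z.
have mH' : measurable_fun setT H'.
  by apply: emeasurable_funM => //; exact: (measurableT_comp mE).
have H'0 z : 0 <= H' z by exact: mule_ge0.
have -> : \int[m]_w ((e w)%:E * \int[nu]_y H (w, y)) =
    \int[m]_w \int[nu]_y H' (w, y).
  apply: eq_integral => w _; rewrite -ge0_integralZl//.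
  exact: (measurableT_comp mH (measurable_pair1 w)).
rewrite !fubini_tonelli// -ge0_integralZl//; last 2 first.
- exact: (measurable_fun_fubini_tonelli_G _ mH).
- by move=> y _; exact: integral_ge0.
apply: ge0_le_integral => //.
- by move=> y _; exact: integral_ge0.
- exact: (measurable_fun_fubini_tonelli_G _ mH').
- by apply: measurable_funeM; exact: (measurable_fun_fubini_tonelli_G _ mH).
- by move=> y _; exact: (hH y).
Qed.

Lemma tilt_le_nneseries (G : nat -> Om -> \bar R) :
  (forall n, measurable_fun setT (G n)) -> (forall n w, 0 <= G n w) ->
  (forall n, tilt_le (G n)) -> tilt_le (fun w => \sum_(0 <= n <oo) G n w).
Proof.
move=> mG G0 hG; rewrite /tilt_le.
under eq_integral do rewrite -nneseriesZl//.
rewrite !integral_nneseries//; last 2 first.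
- by move=> n; exact: emeasurable_funM.
- by move=> n w _; exact: mule_ge0.
rewrite -nneseriesZl; last by move=> n _; exact: integral_ge0.
by apply: lee_nneseries => [n _ _|n _]; [apply: integral_ge0 => w _;
  exact: mule_ge0|exact: hG].
Qed.
End tilting.

Section gaussian_mixture.
Context (R : realType).
Local Notation mu := (@lebesgue_measure R).

(** For [r > 0] the integrand is [r^-1] times the density of the centred normal law of standard
    deviation [r^-1]. For [r = 0] it is a positive constant, and both sides are +oo, in accordance
    with the action where positions coincide. *)
Lemma integral_gauss_mixture (r : R) : 0 <= r ->
  (\int[mu]_u ((Num.sqrt (pi *+ 2))^-1 * expR (- (u ^+ 2 * r ^+ 2 / 2)))%:E)%E =
  (r%:E^-1)%E.
Proof.
rewrite le_eqVlt => /predU1P[<-|r0].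
  rewrite inve0; under eq_integral do
    rewrite expr0n/= mulr0 mul0r oppr0 expR0 mulr1.
  rewrite (@integral_cst _ _ _ mu setT measurableT (Num.sqrt (pi *+ 2))^-1%:E).
  rewrite [X in (_ * X)%E](_ : _ = +oo%E); last first.
    by rewrite -set_itvNyy; exact: lebesgue_measure_itv.
  by rewrite gt0_muley// lte_fin invr_gt0 sqrtr_gt0 mulrn_wgt0// pi_gt0.
have rn0 : r != 0 by rewrite gt_eqF.
rewrite inver (negbTE rn0) -[RHS]mule1 -(@integral_normal_pdf R 0 r^-1).
rewrite -ge0_integralZl//; last 3 first.
- by apply/measurable_EFinP; exact: measurable_normal_pdf.
- by move=> x _; rewrite lee_fin normal_pdf_ge0.
- by rewrite lee_fin invr_ge0 ltW.
apply: eq_integral => u _; rewrite -EFinM; congr (_%:E).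
rewrite normal_pdfE ?invr_eq0// [RHS]mulrA; congr (_ * _); last first.
  by rewrite /normal_fun subr0; congr expR; field.
rewrite /normal_peak -mulrnAr sqrtrM ?sqr_ge0// sqrtr_sqr ger0_norm ?invr_ge0
  ?ltW//.
by rewrite invfM invrK mulrA mulVf// mul1r.
Qed.

End gaussian_mixture.

Section action.
Context (R : realType) (P : probability (path_on [set: R]) R).
Hypothesis hP : brownian_law P.
Variable T : R.
Hypothesis T0 : 0 < T.
Local Notation Om := (path_on (window T)).
Local Notation M := (restr_law P (window T)).
Local Notation mu := (@lebesgue_measure R).
Local Notation linfunc := (@linfunc R T).
Local Notation in_window := (@in_window R T).
Variable L0 : seq (R * R * 'I_3).
Hypothesis L0T : in_window L0.

Let e (w : Om) : R := 1 - cos (linfunc L0 w).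
Let k : R := \int[M]_w e w.

Let bM (G : Om -> R) : measurable_fun setT G -> (forall w, `|G w| <= 1) ->
  M.-integrable setT (EFin \o G).
Proof. by move=> mG G1; exact: (@bounded_integrable _ _ R M G 1 mG G1). Qed.

(** Subtract both sides of the correlation inequality with empty [L] from the mean of [G]. *)
Lemma tilt_le_cos_correlated (G : Om -> R) :
  cos_correlated P L0 G -> tilt_le M e k (EFin \o G).
Proof.
move=> [mG G1 /(_ [::])].
have cos0E w : cos (linfunc [::] w) = 1 by rewrite /linfunc big_nil cos0.
under [X in _ * X]eq_Rintegral do rewrite cos0E mul1r.
under [X in _ <= X]eq_Rintegral do rewrite cos0E mul1r.
have mc : measurable_fun setT (fun w : Om => cos (linfunc L0 w)).
  apply: (measurableT_comp (@measurable_cos R)).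
  exact: measurable_linfunc.
have ic : M.-integrable setT (EFin \o (fun w : Om => cos (linfunc L0 w))).
  by apply: bM => // w; exact: cos_max.
have icG : M.-integrable setT (EFin \o (fun w : Om =>
  cos (linfunc L0 w) * G w)).
  apply: bM => //; first exact: measurable_funM.
  by move=> w; rewrite normrM -[leRHS]mul1r ler_pM// cos_max.
have iG : M.-integrable setT (EFin \o G) by exact: bM.
have i1 : M.-integrable setT (EFin \o (fun=> 1 : R)).
  by apply: bM => // w; rewrite normr1.
have kE : k = 1 - \int[M]_w cos (linfunc L0 w).
  rewrite /k /e RintegralB// Rintegral_cst// mul1r; congr (_ - _).
  by rewrite (_ : fine _ = fine 1%E)//; congr fine; exact: probability_setT.
have nT : in_window [::] by [].
move=> /(_ nT) h.
rewrite /tilt_le.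
have -> : (\int[M]_w ((e w)%:E * (EFin \o G) w))%E =
    ((\int[M]_w G w) - \int[M]_w (cos (linfunc L0 w) * G w))%:E.
  rewrite -RintegralB// /Rintegral fineK.
    by apply: eq_integral => w _; rewrite /e /= -EFinM mulrBl mul1r.
  apply: integrable_fin_num => //.
  rewrite /comp; under eq_fun do rewrite EFinB.
  exact: integrableB.
rewrite -[X in (_ <= _ * X)%E]fineK; last exact: integrable_fin_num.
rewrite -[fine _]/(\int[M]_w G w) -EFinM lee_fin kE mulrBl mul1r.
by rewrite lerD2l lerN2.
Qed.

(** A triple is (u, t, s): each inverse distance in a power of the action contributes one factor,
    with its own mixing variable u. *)
Definition gauss_weight (D : seq (R * R * R)) (w : Om) : R :=
  \prod_(x <- D) expR (- (x.1.1 ^+ 2 *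
    dotv ((w : cpath R) x.1.2 - (w : cpath R) x.2)
         ((w : cpath R) x.1.2 - (w : cpath R) x.2) / 2)).

Definition pairs_in_window (D : seq (R * R * R)) :=
  forall x, x \in D -> window T x.1.2 /\ window T x.2.

Lemma cos_correlated_weight D : pairs_in_window D ->
  cos_correlated P L0 (gauss_weight D).
Proof.
elim: D => [_|x D IH xD].
  rewrite (_ : gauss_weight [::] = cst 1); first exact: cos_correlated_cst1.
  by apply/funext => w; rewrite /gauss_weight big_nil.
have [xt xs] := xD x (mem_head _ _).
have {}IH : cos_correlated P L0 (gauss_weight D).
  by apply: IH => y yD; apply: xD; rewrite in_cons yD orbT.
pose inc (i : 'I_3) : seq (R * R * 'I_3) := [:: (1, x.1.2, i); (-1, x.2, i)].
have incT i : in_window (inc i).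
  by move=> y; rewrite !inE => /orP[] /eqP ->.
have incE i (w : Om) : linfunc (inc i) w =
  ((w : cpath R) x.1.2 - (w : cpath R) x.2) 0 i.
  by rewrite /linfunc !big_cons big_nil !mxE/=; ring.
(* The squared distance is a sum over three coordinates, so one triple costs three Gaussian factors
   with the same parameter. *)
have := cos_correlated_gauss T0 L0T x.1.1 (cos_correlated_gauss T0 L0T x.1.1
  (cos_correlated_gauss T0 L0T x.1.1 IH (incT (inord 0))) (incT (inord 1)))
  (incT (inord 2)).
congr (cos_correlated P L0 _); apply/funext => w;
  rewrite /gauss_weight big_cons -/(gauss_weight D w).
rewrite -!mulrA mulrC -!expRD; congr (expR _ * _).
rewrite !incE /dotv !big_ord_recl big_ord0.
have -> : inord 0 = ord0 :> 'I_3 by apply/val_inj; rewrite /= inordK.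
have -> : inord 1 = lift ord0 ord0 :> 'I_3 by apply/val_inj; rewrite /= inordK.
have -> : inord 2 = lift ord0 (lift ord0 ord0) :> 'I_3 by apply/val_inj;
  rewrite /= inordK.
by field.
Qed.

End action.

Section action_powers.
Context (R : realType) (P : probability (path_on [set: R]) R).
Hypothesis hP : brownian_law P.
Variable T : R.
Hypothesis T0 : 0 < T.
Local Notation Om := (path_on (window T)).
Local Notation M := (restr_law P (window T)).
Local Notation mu := (@lebesgue_measure R).
Local Notation gauss_weight := (@gauss_weight R T).
Local Notation pairs_in_window := (@pairs_in_window R T).
Variables (e : Om -> R) (k : R).
Hypotheses (me : measurable_fun setT e) (e0 : forall w, 0 <= e w) (k0 : 0 <= k).
Local Notation tilt := (tilt_le M e k).

(* Projects the time line onto the window, on which the paths are measurable. *)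
Definition clamp (t : R) : R := Num.max (- T) (Num.min T t).

Lemma clamp_window t : window T (clamp t).
Proof.
have TT : - T <= T by rewrite ge0_cp ?ltW.
by apply/windowP; rewrite /clamp le_max lexx/= ge_max TT ge_min lexx.
Qed.

Lemma clamp_id t : window T t -> clamp t = t.
Proof. by move=> /windowP/andP[Tt tT];
  rewrite /clamp (min_idPr tT) (max_idPr Tt). Qed.

Lemma continuous_clamp : continuous clamp.
Proof.
move=> t; apply: (@continuous_max _ R^o (cst (- T)) (Num.min T)).
  exact: cvg_cst.
by apply: (@continuous_min _ R^o (cst T) id); [exact: cvg_cst|exact: cvg_id].
Qed.

Lemma measurable_clamped_path (i : 'I_3) : measurable_fun setT
  (fun z : Om * R => ((z.1 : cpath R) (clamp z.2) - (z.1 : cpath R) (- T)) 0 i).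
Proof.
pose h (w : Om) (t : R) : R := ((w : cpath R) (clamp t) - (w : cpath R) (- T))
  0 i.
apply: (@measurable_fun_caratheodory _ _ _ h) => [t|w].
  by apply: measurable_incr; [exact: window_left|exact: clamp_window].
move=> t; rewrite /h; under eq_fun do rewrite !mxE.
apply: continuousB; last exact: cvg_cst.
apply: (@continuous_comp _ _ _ (cpath_fun w \o clamp) (fun N : 'rV_3 => N 0 i)).
  apply: continuous_comp; first exact: continuous_clamp.
  exact: (@cts_fun _ _ (w : continuousType R 'rV[R]_3)).
exact: coord_continuous.
Qed.

Let sqd (w : cpath R) (t s : R) : R :=
  dotv (w (clamp t) - w (clamp s)) (w (clamp t) - w (clamp s)).

Let cst_ts (t s : R) : R := \1_(window T) t * \1_(window T) s *
  (expR (- `|t - s|) * (Num.sqrt (pi *+ 2))^-1).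

(** The argument is [(((w, t), s), u)]. Integrating out u, s and t over the whole line gives the
    action, the indicators in [cst_ts] standing for the window. *)
Let kernel (z : ((Om * R) * R) * R) : R :=
  cst_ts z.1.1.2 z.1.2 * expR (- (z.2 ^+ 2 * sqd z.1.1.1 z.1.1.2 z.1.2 / 2)).

Let cst_ge0 t s : 0 <= cst_ts t s.
Proof. by rewrite !mulr_ge0// ?expR_ge0// invr_ge0. Qed.

Let kernel_ge0 z : 0 <= kernel z.
Proof. by rewrite mulr_ge0// expR_ge0. Qed.

Let measurable_kernel : measurable_fun setT kernel.
Proof.
have mw : measurable_fun setT (fun z : ((Om * R) * R) * R => z.1.1.1).
  exact: (measurableT_comp measurable_fst (measurableT_comp measurable_fst
    measurable_fst)).
have mt : measurable_fun setT (fun z : ((Om * R) * R) * R => z.1.1.2).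
  exact: (measurableT_comp measurable_snd (measurableT_comp measurable_fst
    measurable_fst)).
have ms : measurable_fun setT (fun z : ((Om * R) * R) * R => z.1.2).
  exact: (measurableT_comp measurable_snd measurable_fst).
have m1 : measurable_fun setT (\1_(window T) : R -> R).
  by apply: measurable_indic; exact: measurable_window.
apply: measurable_funM.
  apply: measurable_funM.
    apply: measurable_funM; first exact: (measurableT_comp m1 mt).
    exact: (measurableT_comp m1 ms).
  apply: measurable_funM => //; apply: measurableT_comp => //.
  apply: (measurableT_comp (@oppr_measurable R setT)).
  apply: (measurableT_comp (@normr_measurable R setT)).
  exact: measurable_funB.
apply: measurableT_comp => //.
apply: (measurableT_comp (@oppr_measurable R setT)).
apply: measurable_funM => //; apply: measurable_funM.
  by apply: measurable_funX; exact: measurable_snd.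
(* Only increments are measurable, so both positions are taken relative to [w (- T)]. *)
rewrite (_ : (fun z : ((Om * R) * R) * R =>
  sqd z.1.1.1 z.1.1.2 z.1.2) = fun z =>
  \sum_(i < 3) (((z.1.1.1 : cpath R) (clamp z.1.1.2) - (z.1.1.1 : cpath R) (-
    T)) 0 i -
     ((z.1.1.1 : cpath R) (clamp z.1.2) - (z.1.1.1 : cpath R) (- T)) 0 i) ^+
       2); last first.
  apply/funext => z; rewrite /sqd /dotv; apply: eq_bigr => i _.
  by rewrite !mxE; ring.
apply: measurable_sum => i; apply: measurable_funX; apply: measurable_funB.
  exact: (measurableT_comp (measurable_clamped_path i) (measurable_fun_pair mw
    mt)).
exact: (measurableT_comp (measurable_clamped_path i) (measurable_fun_pair mw
  ms)).
Qed.

Let k3 := fubini_F mu (EFin \o kernel).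
Let k2 := fubini_F mu k3.

Let k3_ge0 z : (0 <= k3 z)%E.
Proof. by apply: integral_ge0 => u _; rewrite lee_fin. Qed.

Let k2_ge0 z : (0 <= k2 z)%E.
Proof. by apply: integral_ge0 => u _; exact: k3_ge0. Qed.

Let mk3 : measurable_fun setT k3.
Proof.
apply: measurable_fun_fubini_tonelli_F; first exact/measurable_EFinP.
by move=> z; rewrite lee_fin.
Qed.

Let mk2 : measurable_fun setT k2.
Proof. exact: measurable_fun_fubini_tonelli_F. Qed.

Lemma dotv_ge0 (n : nat) (x : 'rV[R]_n) : 0 <= dotv x x.
Proof. by apply: sumr_ge0 => i _; rewrite -expr2 sqr_ge0. Qed.

Let actionE w : polaron_action T w = fubini_F mu k2 w.
Proof.
rewrite /polaron_action [LHS]integral_mkcond; apply: eq_integral => t _.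
rewrite patchE; case: ifPn => tT; last first.
  rewrite /k2 /fubini_F integral0_eq// => s _;
    rewrite /k3 /fubini_F integral0_eq// => u _.
  by rewrite /kernel /cst_ts /= indicE (negbTE tT) !mul0r.
rewrite [LHS]integral_mkcond; apply: eq_integral => s _.
rewrite patchE; case: ifPn => sT; last first.
  rewrite /k3 /fubini_F integral0_eq// => u _.
  by rewrite /kernel /cst_ts /= !indicE (negbTE sT) mulr0 !mul0r.
rewrite /k3 /fubini_F -(integral_gauss_mixture (sqrtr_ge0 _)).
rewrite -ge0_integralZl//; last first.
- apply/measurable_EFinP; apply: measurable_funM => //;
    apply: measurableT_comp => //.
  apply: (measurableT_comp (@oppr_measurable R setT)).
  by apply: measurable_funM => //; apply: measurable_funM => //;
    exact: measurable_funX.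
apply: eq_integral => u _; rewrite -EFinM /kernel /cst_ts /= !indicE tT sT
  !mul1r mulrA.
rewrite /sqd !clamp_id; [|by move: sT; rewrite inE|by move: tT; rewrite inE].
by rewrite sqr_sqrtr// dotv_ge0.
Qed.

(** Quantifying over [D] gives a property that multiplication by the action preserves: the new
    factor adds a triple to [D]. *)
Definition tiltable (G : Om -> \bar R) := [/\ measurable_fun setT G,
  (forall w, 0 <= G w)%E &
  forall D, pairs_in_window D -> tilt (fun w => G w * (gauss_weight D w)%:E)%E].

Let gw_ge0 D w : 0 <= gauss_weight D w.
Proof. by apply: prodr_ge0 => i _; exact: expR_ge0. Qed.

Hypothesis mgw : forall D, pairs_in_window D -> measurable_fun setT
  (gauss_weight D).

(** The product is a triple integral over t, s and u of [G] times an enlarged Gaussian weight;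
    [tilt_le_integral] removes the three integrals one at a time. *)
Lemma tiltableM (G : Om -> \bar R) : tiltable G ->
  tiltable (fun w => (polaron_action T w * G w)%E).
Proof.
move=> [mG G0 hG].
have mA : measurable_fun setT (polaron_action T : Om -> \bar R).
  exact: measurable_polaron_action.
have A0 (w : Om) : (0 <= polaron_action T w)%E.
  by rewrite actionE; apply: integral_ge0 => t _; exact: k2_ge0.
split => [|w|D DT]; [exact: emeasurable_funM|exact: mule_ge0|].
pose H w := (G w * (gauss_weight D w)%:E)%E.
have mH : measurable_fun setT H.
  by apply: emeasurable_funM => //; apply/measurable_EFinP; exact: mgw.
have H0 w : (0 <= H w)%E by rewrite mule_ge0// lee_fin.
pose F4 z := ((kernel z)%:E * H z.1.1.1)%E.
have mF4 : measurable_fun setT F4.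
  apply: emeasurable_funM; first exact/measurable_EFinP.
  apply: (measurableT_comp mH).
  exact: (measurableT_comp measurable_fst (measurableT_comp measurable_fst
    measurable_fst)).
have F40 z : (0 <= F4 z)%E by rewrite mule_ge0// lee_fin.
have F3E z : fubini_F mu F4 z = (k3 z * H z.1.1)%E.
  rewrite /k3 /fubini_F -ge0_integralZr//.
  - apply/measurable_EFinP.
    exact: (measurableT_comp measurable_kernel (measurable_pair1 z)).
  - by move=> u _; rewrite lee_fin.
have F2E z : fubini_F mu (fubini_F mu F4) z = (k2 z * H z.1)%E.
  have mz : measurable_fun setT (fun s => k3 (z, s)).
    exact: (measurableT_comp mk3 (measurable_pair1 z)).
  transitivity (\int[mu]_s (k3 (z, s) * H z.1))%E.
    by apply: eq_integral => s _; exact: F3E.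
  apply: (@ge0_integralZr _ _ _ mu setT measurableT _ mz) => [s _|];
    last exact: H0.
  exact: k3_ge0.
have F1E w : fubini_F mu (fubini_F mu (fubini_F mu F4)) w =
  (polaron_action T w * H w)%E.
  have mw : measurable_fun setT (fun t => k2 (w, t)).
    exact: (measurableT_comp mk2 (measurable_pair1 w)).
  transitivity (\int[mu]_t (k2 (w, t) * H w))%E.
    by apply: eq_integral => t _; exact: F2E.
  rewrite actionE.
  apply: (@ge0_integralZr _ _ _ mu setT measurableT _ mw) => [t _|];
    last exact: H0.
  exact: k2_ge0.
have mF3 := measurable_fun_fubini_tonelli_F (m2 := mu) F4 mF4 F40.
have F30 z : (0 <= fubini_F mu F4 z)%E by exact: integral_ge0.
have mF2 := measurable_fun_fubini_tonelli_F (m2 := mu) _ mF3 F30.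
have F20 z : (0 <= fubini_F mu (fubini_F mu F4) z)%E by exact: integral_ge0.
rewrite (_ : (fun w => _) = fubini_F mu (fubini_F mu (fubini_F mu F4)));
  last first.
  by apply/funext => w; rewrite F1E muleA.
apply: (tilt_le_integral me e0 k0 mu mF2 F20) => t.
pose F3t (z : Om * R) := fubini_F mu F4 (z.1, t, z.2).
have mF3t : measurable_fun setT F3t.
  apply: (measurableT_comp mF3).
  apply: measurable_fun_pair; last exact: measurable_snd.
  by apply: measurable_fun_pair; [exact: measurable_fst|exact: measurable_cst].
have F3t0 z : (0 <= F3t z)%E by exact: F30.
rewrite (_ : (fun w => _) = fubini_F mu F3t); last first.
  by apply/funext => w; rewrite /F3t /fubini_F.
apply: (tilt_le_integral me e0 k0 mu mF3t F3t0) => s.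
pose F4ts (z : Om * R) := F4 (z.1, t, s, z.2).
have mF4ts : measurable_fun setT F4ts.
  apply: (measurableT_comp mF4).
  apply: measurable_fun_pair; last exact: measurable_snd.
  apply: measurable_fun_pair; last exact: measurable_cst.
  by apply: measurable_fun_pair; [exact: measurable_fst|exact: measurable_cst].
have F4ts0 z : (0 <= F4ts z)%E by exact: F40.
rewrite (_ : (fun w => _) = fubini_F mu F4ts); last first.
  by apply/funext => w; rewrite /F3t /F4ts /fubini_F.
apply: (tilt_le_integral me e0 k0 mu mF4ts F4ts0) => u.
(* Clamping keeps the added times in the window for all real [t] and [s]; when one lies outside,
   [cst_ts t s] is 0. *)
have DT' : pairs_in_window ((u, clamp t, clamp s) :: D).
  by move=> x; rewrite in_cons => /orP[/eqP ->|/DT//]; split;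
    exact: clamp_window.
rewrite (_ : (fun w => _) = fun w => ((cst_ts t s)%:E *
    (G w * (gauss_weight ((u, clamp t, clamp s) :: D) w)%:E))%E); last first.
  apply/funext => w; rewrite /F4ts /F4 /kernel /H /gauss_weight big_cons /=.
  by rewrite -/(gauss_weight D w) EFinM -!muleA; congr (_ * _)%E;
    rewrite EFinM muleCA.
apply: tilt_leZ => //.
- by apply: emeasurable_funM => //; apply/measurable_EFinP; exact: mgw.
- by move=> w; rewrite mule_ge0// lee_fin.
- exact: hG.
Qed.

End action_powers.

(** * From cosines to squares *)

Section real_bounds.
Context (R : realType).

Lemma sin_MVT (y : R) : exists2 c, `|c| <= `|y| & sin y = cos c * y.
Proof.
have pos (x : R) : 0 <= x -> exists2 c, `|c| <= `|x| & sin x = cos c * x.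
  move=> x0.
  have [c] := @MVT_segment R sin cos 0 x x0 (fun z _ => is_derive_sin z)
    (continuous_subspaceT (@continuous_sin R)).
  rewrite in_itv/= => /andP[c0 cx]; rewrite sin0 !subr0 => ->.
  by exists c => //; rewrite !ger0_norm.
have [/pos//|/ltW y0] := leP 0 y.
have [|c cy sE] := pos (- y); first by rewrite oppr_ge0.
by exists c; [rewrite -[`|y|]normrN|move: sE; rewrite sinN mulrN => /oppr_inj].
Qed.

Lemma sin_sqr_le (y : R) : sin y ^+ 2 <= y ^+ 2.
Proof.
by have [c _ ->] := sin_MVT y; rewrite exprMn ler_piMl ?sqr_ge0//.
Qed.

Lemma one_sub_cosE (h : R) : 1 - cos h = 2 * sin (h / 2) ^+ 2.
Proof.
have -> : cos h = cos ((h / 2) *+ 2) by congr cos; rewrite -mulr_natr; field.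
by rewrite cos_mulr2n cos2sin2 -mulr_natl; ring.
Qed.

Lemma one_sub_cos_le (h : R) : 1 - cos h <= h ^+ 2 / 2.
Proof. by rewrite one_sub_cosE; have := sin_sqr_le (h / 2); lra. Qed.

(** By the mean value theorem [sin (h / 2)] is [cos c * (h / 2)] with [|c| <= |h / 2|], and the
    squared cosine is at least [1 - c ^+ 2]. *)
Lemma one_sub_cos_ge (h : R) : h ^+ 2 / 2 * (1 - h ^+ 2 / 4) <= 1 - cos h.
Proof.
rewrite one_sub_cosE; have [c ch ->] := sin_MVT (h / 2).
have c2 : c ^+ 2 <= h ^+ 2 / 4.
  rewrite -[c ^+ 2]real_normK ?num_real// (_ : h ^+ 2 / 4 = `|h / 2| ^+ 2).
    by rewrite ler_sqr ?nnegrE.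
  by rewrite real_normK ?num_real//; field.
rewrite exprMn cos2sin2 (_ : (h / 2) ^+ 2 = h ^+ 2 / 4); last by field.
have := sin_sqr_le c; have := sqr_ge0 h; set s := sin c ^+ 2; set x := h ^+ 2.
move: c2; rewrite -/x; set d := c ^+ 2 => dx x0 sd.
have := mulr_ge0 x0 (_ : 0 <= x / 4 - s); move=> /(_ _) H.
have {}H := H ltac:(lra); lra.
Qed.

Lemma cvg_one_sub_cos (x : R) :
  2 * n.+1%:R ^+ 2 * (1 - cos (n.+1%:R^-1 * x)) @[n --> \oo] --> x ^+ 2.
Proof.
apply: (@squeeze_cvgr _ _ _ _ (fun n =>
  x ^+ 2 * (1 - n.+1%:R^-1 * (n.+1%:R^-1 * (x ^+ 2 / 4)))) (cst (x ^+ 2))).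
- apply: nearW => n /=; have n0 : n.+1%:R != 0 :> R by rewrite pnatr_eq0.
  have n2 : 0 < 2 * n.+1%:R ^+ 2 :> R by rewrite mulr_gt0// exprn_gt0.
  move: (n.+1%:R : R) n0 n2 => N n0 n2.
  apply/andP; split.
    have := one_sub_cos_ge (N^-1 * x); rewrite -(ler_pM2l n2); apply: le_trans.
    by rewrite le_eqVlt; apply/orP; left; apply/eqP; field.
  have := one_sub_cos_le (N^-1 * x); rewrite -(ler_pM2l n2) => /le_trans; apply.
  by rewrite le_eqVlt; apply/orP; left; apply/eqP; field.
- have h1 : (fun n : nat => n.+1%:R^-1 : R) @ \oo --> (0 : R) by exact:
    cvg_harmonic.
  have h2 : (fun n : nat => n.+1%:R^-1 * (n.+1%:R^-1 * (x ^+ 2 / 4)) : R) @ \oo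
    -->
      (0 * (0 * (x ^+ 2 / 4)) : R).
    by apply: cvgM => //; apply: cvgM => //; exact: cvg_cst.
  have h3 : (fun n : nat => 1 - n.+1%:R^-1 * (n.+1%:R^-1 * (x ^+ 2 / 4)) : R) @
    \oo -->
      (1 - 0 * (0 * (x ^+ 2 / 4)) : R).
    by apply: cvgB => //; exact: cvg_cst.
  have h4 : (fun n : nat => x ^+ 2 * (1 - n.+1%:R^-1 * (n.+1%:R^-1 * (x ^+ 2 /
    4))) : R) @ \oo -->
      (x ^+ 2 * (1 - 0 * (0 * (x ^+ 2 / 4))) : R).
    by apply: cvgM => //; exact: cvg_cst.
  by rewrite !mul0r subr0 mulr1 in h4.
- exact: cvg_cst.
Qed.

Lemma expeR_nneseries (c : R) (x : \bar R) : 0 < c -> (0 <= x)%E ->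
  expeR (c%:E * x) = (\sum_(0 <= n <oo) (c ^+ n / n`!%:R)%:E * x ^+ n)%E.
Proof.
move=> c0; have t0 y n : (0 <= y -> 0 <= (c ^+ n / n`!%:R)%:E * y ^+ n)%E.
  by move=> y0; rewrite mule_ge0 ?expe_ge0// lee_fin divr_ge0// exprn_ge0// ltW.
case: x => [r| |] //.
- move=> r0; rewrite -EFinM /= /expR.
  rewrite -EFin_lim; last exact: is_cvg_series_exp_coeff.
  congr (limn _); apply/funext => n.
  rewrite /series /= -sumEFin; apply: eq_bigr => i _.
  by rewrite -EFin_expe -EFinM /exp_coeff/= exprMn mulrAC.
(* At +oo the terms of index 0 and 1 already have an infinite sum. *)
- move=> y0; rewrite gt0_muley ?lte_fin//=; apply/esym/eqP; rewrite -leye_eq.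
  apply: le_trans (nneseries_lim_ge 2 _); last by move=> n _ _; exact: t0.
  rewrite !big_nat_recr//= big_nil [X in (_ + X)%R]gt0_muley ?addey//.
  by rewrite lte_fin divr_gt0 ?exprn_gt0.
Qed.

End real_bounds.

Section weight.
Context (R : realType) (P : probability (path_on [set: R]) R).
Hypothesis hP : brownian_law P.
Variables (alpha T : R).
Hypothesis (alpha0 : 0 < alpha) (T0 : 0 < T).
Local Notation Om := (path_on (window T)).
Local Notation M := (restr_law P (window T)).
Local Notation W := (polaron_weight alpha T).
Local Notation Z := (polaron_Z P alpha T).

Lemma polaron_action_ge0 (w : cpath R) : (0 <= polaron_action T w)%E.
Proof.
apply: integral_ge0 => t _; apply: integral_ge0 => s _.
by rewrite mule_ge0// ?lee_fin ?expR_ge0// inve_ge0 lee_fin sqrtr_ge0.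
Qed.

(** Keeps the weight and its mean [Z] away from 0, where products with +oo and inverses
    degenerate. *)
Lemma polaron_weight_ge1 (w : cpath R) : (1 <= W w)%E.
Proof.
have := polaron_action_ge0 w; rewrite /polaron_weight.
case: (polaron_action T w) => [r| |]//.
- by rewrite lee_fin => r0; rewrite -EFinM lee_fin -expR0 ler_expR mulr_ge0//
    divr_ge0// ltW.
- by move=> _; rewrite gt0_muley ?lte_fin ?divr_gt0//= leey.
Qed.

(** The constant 1 is tiltable by the correlation inequality, hence so is every power of the action;
    the exponential series has nonnegative coefficients as [alpha > 0]. *)
Lemma tilt_le_polaron_weight (L : seq (R * R * 'I_3)) : in_window T L ->
  tilt_le M (fun w => 1 - cos (linfunc T L w))
    (\int[M]_w (1 - cos (linfunc T L w))) (W : Om -> \bar R).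
Proof.
move=> LT; set e := fun w : Om => _; set k := \int[M]_w _.
have me : measurable_fun setT e.
  apply: measurable_funB => //.
  apply: (measurableT_comp (@measurable_cos R)).
  exact: measurable_linfunc.
have e0 w : 0 <= e w by rewrite subr_ge0 cos_le1.
have k0 : 0 <= k by apply: Rintegral_ge0 => w _; exact: e0.
have mgw D : pairs_in_window T D -> measurable_fun setT (gauss_weight D : Om ->
  R).
  by move=> /(cos_correlated_weight hP T0 LT) [].
have t1 : tiltable P e k (fun=> 1%E).
  split => // D DT.
  have := tilt_le_cos_correlated T0 LT (cos_correlated_weight hP T0 LT DT).
  by congr (tilt_le _ _ _ _); apply/funext => w; rewrite mul1e.
have tn n : tiltable P e k (fun w => polaron_action T w ^+ n)%E.
  elim: n => [|n IH]; first by under eq_fun do rewrite expe0.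
  under eq_fun do rewrite expeS.
  exact: (tiltableM T0 me e0 k0 mgw IH).
have a2 : 0 < alpha / 2 by rewrite divr_gt0.
have c0 n : 0 <= (alpha / 2) ^+ n / n`!%:R by rewrite divr_ge0// exprn_ge0//
  ltW.
rewrite (_ : (W : Om -> \bar R) = fun w => (\sum_(0 <= n <oo)
    ((alpha / 2) ^+ n / n`!%:R)%:E * polaron_action T w ^+ n)%E); last first.
  by apply/funext => w; rewrite /polaron_weight expeR_nneseries//
    polaron_action_ge0.
apply: tilt_le_nneseries => //.
- by move=> n; apply: measurable_funeM; case: (tn n).
- by move=> n w; rewrite mule_ge0 ?lee_fin// expe_ge0// polaron_action_ge0.
- move=> n; have [mn n0 tl] := tn n; apply: tilt_leZ => //.
  have nT : pairs_in_window T [::] by [].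
  have := tl [::] nT; congr (tilt_le _ _ _ _); apply/funext => w.
  by rewrite /gauss_weight big_nil mule1.
Qed.

(** The functions [f n] lie below the square and converge to it, so the means of [f n] times the
    weight all have the same bound, which Fatou's lemma hands to the limit. *)
Lemma linfunc_sqr_weight_le (L : seq (R * R * 'I_3)) : in_window T L ->
  (\int[M]_w ((linfunc T L w ^+ 2)%:E * W w) <=
   (\int[M]_w (linfunc T L w ^+ 2)%:E) * Z)%E.
Proof.
move=> LT.
pose f n (w : Om) : R := 2 * n.+1%:R ^+ 2 * (1 - cos (n.+1%:R^-1 * linfunc T L
  w)).
have n2 n : 0 <= 2 * n.+1%:R ^+ 2 :> R by rewrite mulr_ge0// sqr_ge0.
have f0 n w : 0 <= f n w by rewrite mulr_ge0// subr_ge0 cos_le1.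
have mL := measurable_linfunc T0 LT.
have mW : measurable_fun setT (W : Om -> \bar R) :=
  @measurable_polaron_weight R alpha T.
have W0 (w : Om) : (0 <= W w)%E by apply: le_trans (polaron_weight_ge1 w).
have fL n w : f n w <= linfunc T L w ^+ 2.
  apply: le_trans (ler_wpM2l (n2 n) (one_sub_cos_le _)) _.
  have : n.+1%:R != 0 :> R by rewrite pnatr_eq0.
  rewrite /f; move: (n.+1%:R : R) (linfunc T L w) => N x N0.
  by rewrite le_eqVlt; apply/orP; left; apply/eqP; field.
have mf n : measurable_fun setT (f n).
  apply: measurable_funM => //; apply: measurable_funB => //.
  apply: (measurableT_comp (@measurable_cos R)).
  exact: measurable_funM.
have mfW n : measurable_fun setT (fun w => ((f n w)%:E * W w)%E).
  by apply: emeasurable_funM => //; exact/measurable_EFinP.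
have Z0 : (0 <= Z)%E by apply: integral_ge0 => w _; exact: W0.
have fW n : (\int[M]_w ((f n w)%:E * W w) <=
  (\int[M]_w (linfunc T L w ^+ 2)%:E) * Z)%E.
  pose g (w : Om) := 1 - cos (linfunc T (linscale n.+1%:R^-1 L) w).
  have g0 w : 0 <= g w by rewrite subr_ge0 cos_le1.
  have fE w : f n w = 2 * n.+1%:R ^+ 2 * g w by rewrite /g linfunc_scale.
  have mg : measurable_fun setT g.
    apply: measurable_funB => //.
    apply: (measurableT_comp (@measurable_cos R)).
    by apply: measurable_linfunc => //; exact: in_window_scale.
  have ig : M.-integrable setT (EFin \o g).
    apply: (@bounded_integrable _ _ R M g 2 mg) => w.
    by rewrite ger0_norm// /g; have :=
      cos_geN1 (linfunc T (linscale n.+1%:R^-1 L) w); lra.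
  have tl := tilt_le_polaron_weight (@in_window_scale R T n.+1%:R^-1 L LT).
  apply: (@le_trans _ _ ((\int[M]_w (f n w)%:E) * Z)%E); last first.
    apply: lee_wpmul2r => //; apply: ge0_le_integral => //.
    - by move=> w _; rewrite lee_fin.
    - exact/measurable_EFinP.
    - by apply/measurable_EFinP; exact: measurable_funX.
    - by move=> w _; rewrite lee_fin.
  under eq_integral do rewrite fE EFinM -muleA.
  under [X in (_ <= X * _)%E]eq_integral do rewrite fE EFinM.
  rewrite !ge0_integralZl//.
  + rewrite -muleA; apply: lee_wpmul2l; first by rewrite lee_fin.
    move: tl; rewrite /tilt_le -/g; congr (_ <= _ * _)%E.
    by rewrite /Rintegral fineK// integrable_fin_num.
  + by apply: emeasurable_funM => //; exact/measurable_EFinP.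
  + by move=> w _; rewrite mule_ge0// lee_fin.
  + exact/measurable_EFinP.
  + by move=> w _; rewrite lee_fin.
have lim (w : Om) : ((f n w)%:E * W w)%E @[n --> \oo] --> ((linfunc T L w ^+
  2)%:E * W w)%E.
  (* The weight may be +oo, so the limit of the product needs a nonzero limit of [f n w]; if the
     functional vanishes, all [f n w] are 0. *)
  have [l0|l0] := eqVneq (linfunc T L w) 0.
    have fw0 n : f n w = 0.
      by apply/eqP; rewrite eq_le f0 andbT (le_trans (fL n w))// l0 expr0n.
    under eq_fun do rewrite fw0 mul0e.
    by rewrite l0 expr0n/= mul0e; exact: cvg_cst.
  apply: cvgeM.
  - rewrite mule_defE negb_or !negb_and eqe expf_eq0/= l0/=.
    by rewrite gt_eqF//; apply: lt_le_trans (polaron_weight_ge1 w).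
  - by apply: cvg_EFin; [exact: nearW|exact: cvg_one_sub_cos].
  - exact: cvg_cst.
have fW0 n (w : Om) : setT w -> (0 <= (f n w)%:E * W w)%E.
  by move=> _; rewrite mule_ge0// lee_fin.
have -> : (\int[M]_w ((linfunc T L w ^+ 2)%:E * W w) =
    \int[M]_w limn_einf (fun n => ((f n w)%:E * W w)))%E.
  by apply: eq_integral => w _; rewrite (cvg_limn_einf_sup (lim w)).
apply: le_trans (fatou M measurableT mfW fW0) _.
(* The lower limit is the limit of the infima over tails, each at most the first term of its
   tail. *)
rewrite limn_einf_lim; apply: lime_le; first exact: is_cvg_einfs.
apply: nearW => n; apply: le_trans (fW n); apply: ereal_inf_lbound.
by exists n => /=.
Qed.

End weight.

Theorem corollary3p2 (R : realType)
    (P : probability (path_on [set: R]) R) (hP : brownian_law P)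
    (alpha T : R) (halpha : 0 < alpha) (hT : 0 < T)
    (v : 'rV[R]_3) (hv : enorm v = 1) :
  (\int[polaron_law P alpha T]_w
      ((dotv v ((w : cpath R) T - (w : cpath R) (- T)%R)) ^+ 2)%:E
   <= \int[restr_law P (window T)]_w
      ((dotv v ((w : cpath R) T - (w : cpath R) (- T)%R)) ^+ 2)%:E)%E.
Proof.
(* The coordinates of [v] at time [T]: the base point [- T] makes this the increment over the whole
   window in direction [v]. *)
pose L := [seq (v 0 i, T, i) | i <- enum 'I_3].
have LT : in_window T L.
  by move=> x /mapP[i _ ->]; apply/windowP; rewrite lexx ge0_cp ?ltW.
have LE (w : cpath R) : dotv v (w T - w (- T)) = linfunc T L w.
  by rewrite /dotv /linfunc big_map big_enum.
pose M := restr_law P (window T); pose W := polaron_weight alpha T.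
pose Z := polaron_Z P alpha T.
have W1 := @polaron_weight_ge1 R alpha T halpha.
have mW : measurable_fun setT (W : path_on (window T) -> \bar R) :=
  @measurable_polaron_weight R alpha T.
have mL := measurable_linfunc hT LT.
have Z1 : (1 <= Z)%E.
  rewrite -(@probability_setT _ _ R M) -[leLHS]mul1e -integral_cst//.
  by apply: ge0_le_integral => //.
have Zi0 : (0 <= Z^-1)%E by rewrite inve_ge0; apply: le_trans Z1.
under eq_integral do rewrite LE.
under [leRHS]eq_integral do rewrite LE.
rewrite (@ge0_integral_density _ _ _ _ R M (polaron_law P alpha T) _
  (@measurable_id _ _ setT) (fun w => W w * Z^-1)%E)//; last 4 first.
- exact: emeasurable_funM.
- by move=> w; rewrite mule_ge0// (le_trans _ (W1 w)).
- by apply/measurable_EFinP; exact: measurable_funX.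
- by move=> w; rewrite lee_fin sqr_ge0.
under eq_integral do rewrite muleA.
rewrite ge0_integralZr//; last 2 first.
- by apply: emeasurable_funM => //; apply/measurable_EFinP;
    exact: measurable_funX.
- by move=> w _; rewrite mule_ge0 ?lee_fin ?sqr_ge0// (le_trans _ (W1 w)).
have := linfunc_sqr_weight_le hP halpha hT LT; rewrite -/Z -/M -/W.
have [Zy|Zfin] := eqVneq Z +oo%E.
  by rewrite Zy invey mule0 => _; apply: integral_ge0 => w _;
    rewrite lee_fin sqr_ge0.
have [z zE] : exists z, Z = z%:E.
  by move: Zfin Z1; case: (Z) => [z| |]// _ _; exists z.
have z1 : 1 <= z by move: Z1; rewrite zE.
have z0 : z != 0 by rewrite gt_eqF// (lt_le_trans _ z1).
rewrite zE inver (negbTE z0) => h;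
  rewrite -[leRHS]mule1 -(divff z0) EFinM muleA.
by apply: lee_wpmul2r h; rewrite lee_fin invr_ge0 (le_trans _ z1).
Qed.
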